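(* Assume that the following hypotheses hold (notation in context): the generator $\mathcal{L}$ is self-adjoint in $L^2(\nu)$; the Yaglom limit $\mu:=\lim_{t\to+\infty}T_t(\nu)$ exists, with a corresponding $\lambda>0$ such that $\lambda=-\lim_{t\to\infty}\frac1t\log P_\nu(\tau>t)$; the density $u:=d\mu/d\nu$ exists and belongs to $L^2(\nu)$, $u$ is a simple eigenfunction for $\lambda$, $u$ is positive $\nu$-a.s. on $\mathcal{A}^c$; and $dT_t(\nu)/d\nu\to u$ in $L^2(\nu)$ as $t\to\infty$. Let $t\mapsto a_t$ be an increasing positive function such that $\lim_{t\to\infty}a_t=\lim_{t\to\infty}(t-a_t)=\infty$. Then for any $r>0$, the law of $\{\eta_{a_t+s},s\in[0,r]\}$ conditioned on $\{\tau>t\}$ with initial measure $\nu$ converges, as $t\to\infty$, to the restriction to the time interval $[0,r]$ of $\int P^u_\eta\,d\hat\mu(\eta)$, where convergence is in the topology induced by duality against bounded measurable functions: for every bounded measurable functional $\varphi$ of paths on $[0,r]$, $$E_\nu\bigl[\varphi\bigl((\eta_{a_t+s})_{s\in[0,r]}\bigr)\,\big|\,\tau>t\bigr]\longrightarrow\int E^u_\eta\bigl[\varphi\bigl((\eta_s)_{s\in[0,r]}\bigr)\bigr]\,d\hat\mu(\eta).$$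
   Context: Setting: $(\eta_t)_{t\ge0}$ is a càdlàg Markov process on $\Omega=\{0,1\}^{\mathbb{Z}^d}$ with generator $\mathcal{L}$ and invariant probability measure $\nu$; $P_\eta$, $P_\nu$ denote its law started from $\eta$, resp. from $\nu$, with expectations $E_\eta,E_\nu$. $\mathcal{A}\subset\Omega$ is a local pattern, i.e. an event depending only on finitely many coordinates, and $\tau=\inf\{t:\eta_t\in\mathcal{A}\}$. $T_t(\nu)$ is the law of $\eta_t$ conditioned on $\{\tau>t\}$ when $\eta_0$ has law $\nu$. Killed semigroup: $\overline{S}_tf(\eta)=E_\eta[f(\eta_t)\mathbb{1}_{\{\tau>t\}}]$, a semigroup on $L^2(\nu)$-functions vanishing on $\mathcal{A}$, with generator $\overline{\mathcal{L}}$ (formally $\mathbb{1}_{\mathcal{A}^c}\mathcal{L}$). ''$u$ is a simple eigenfunction for $\lambda$'' means that $\overline{S}_tu=e^{-\lambda t}u$ $\nu$-a.s. for all $t\ge0$ and that the corresponding eigenspace in $L^2(\nu)$ is one-dimensional, spanned by $u$. $\hat\mu$ is the probability measure $d\hat\mu=u^2\,d\nu/\int u^2\,d\nu$. For ($\hat\mu$-almost every) $\xi\in\mathcal{A}^c$, $P^u_\xi$ is the law on paths given, for every $t\ge0$ and every measurable set $\Gamma$ of paths depending only on times in $[0,t]$, by $$P^u_\xi(\eta_{[0,t]}\in\Gamma)=\frac1{u(\xi)}E_\xi\bigl[\mathbb{1}_\Gamma(\eta_{[0,t]})\,u(\eta_t)\,e^{\lambda t}\,\mathbb{1}_{\{\tau>t\}}\bigr],$$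 with expectation $E^u_\xi$; it is the Markov process, reversible with respect to $\hat\mu$, formally generated on $\mathcal{A}^c$ by $\mathcal{L}_u\varphi=(\mathcal{L}(u\varphi)-\varphi\mathcal{L}(u))/u$. *)

(* Defs.v *)
From HB Require Import structures.
From mathcomp Require Import all_boot all_order all_algebra.
From mathcomp Require Import all_classical all_reals all_analysis.
From mathcomp Require Import measurable_realfun.

Set Implicit Arguments.
Unset Strict Implicit.
Unset Printing Implicit Defensive.

Import Order.TTheory GRing.Theory Num.Theory.
Import numFieldNormedType.Exports.

Local Open Scope classical_set_scope.
Local Open Scope ring_scope.

(* Omega = {0,1}^(Z^d), with the product topology and the product
   sigma-algebra. *)
Definition config (d : nat) : Type := 'rV[int]_d -> bool.

HB.instance Definition _ d :=
  Topological.copy (config d) {ptws 'rV[int]_d -> bool}.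
HB.instance Definition _ d := isPointed.Build (config d) (fun=> false).

Definition cylinders d : set (set (config d)) :=
  [set C | exists x : 'rV[int]_d, C = [set eta : config d | eta x]].

HB.instance Definition _ d := @isMeasurable.Build (sigma_display (@cylinders d))
  (config d) <<s @cylinders d >> (@sigma_algebra0 _ setT (@cylinders d))
  (@sigma_algebraC _ (@cylinders d))
  (@sigma_algebra_bigcup _ setT (@cylinders d)).

(* A cadlag path on [0, +oo[ is encoded by its extension to R which is constant
   on ]-oo, 0]; this is a bijection, and it makes paths total functions of a
   real time. *)
Record cadlag_path (R : realType) (d : nat) := CadlagPath {
  path_fun :> R -> config d ;
  path_rcont : forall t, path_fun s @[s --> t^'+] --> path_fun t ;
  path_llim : forall t, cvg (path_fun s @[s --> t^'-]) ;
  path_neg : forall t, t < 0 -> path_fun t = path_fun 0 }.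

Section path_space.
Variables (R : realType) (d : nat).
Notation path := (cadlag_path R d).

Definition cst_path (eta : config d) : path :=
  @CadlagPath R d (fun=> eta) (fun=> cvg_cst eta) (fun=> is_cvg_cst eta)
    (fun _ _ => erefl).

HB.instance Definition _ := gen_eqMixin path.
HB.instance Definition _ := gen_choiceMixin path.
HB.instance Definition _ := isPointed.Build path (cst_path point).

Definition evaluations (I : set R) : set (set path) :=
  [set G | exists s, I s /\ exists B, measurable B /\ G = [set w : path | B (w s)]].

(* sigma-algebra of the events depending only on times in [0, t] *)
Definition history (t : R) : set (set path) := <<s evaluations `[0, t] >>.

Definition history_measurable (r : R) (phi : path -> R) : Prop :=
  forall B : set R, measurable B -> history r (phi @^-1` B).

Notation evals := (evaluations `[0, +oo[).

HB.instance Definition _ := @isMeasurable.Build (sigma_display evals)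
  path <<s evals >> (@sigma_algebra0 _ setT evals)
  (@sigma_algebraC _ evals) (@sigma_algebra_bigcup _ setT evals).

End path_space.

Section shift.
Variables (R : realType) (d : nat) (a : R) (w : cadlag_path R d).

Let shifted t := w (a + Num.max 0 t).

Let shifted_neg t : t < 0 -> shifted t = shifted 0.
Proof. by move=> t0; rewrite /shifted !max_l // ltW. Qed.

Let cvg_addr_right t : (a + s) @[s --> t^'+] --> (a + t)^'+.
Proof.
move=> P /nbhs_right0P [e /= e0 He]; apply/nbhs_right0P.
by exists e => //= z ze z0; rewrite /= addrA; exact: He.
Qed.

Let cvg_addr_left t : (a + s) @[s --> t^'-] --> (a + t)^'-.
Proof.
move=> P /nbhs_left0P [e /= e0 He]; apply/nbhs_left0P.
by exists e => //= z ze z0; rewrite /= addrA; exact: He.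
Qed.

Let near_cvg (F : set_system R) {FF : Filter F} (f g : R -> config d)
    (l : config d) :
  {near F, f =1 g} -> f s @[s --> F] --> l -> g s @[s --> F] --> l.
Proof. by move=> fg; apply: cvg_trans; exact: near_eq_cvg. Qed.

Let shifted_rcont t : shifted s @[s --> t^'+] --> shifted t.
Proof.
have [t0|t0] := ltP t 0.
  rewrite (shifted_neg t0); apply: (@near_cvg _ _ (fun=> shifted 0)).
    by near=> s; rewrite [RHS]shifted_neg.
  exact: cvg_cst.
rewrite [X in _ --> X]/shifted max_r //.
apply: (@near_cvg _ _ (w \o +%R a)).
  near=> s; rewrite /= /shifted max_r //.
  by apply: (le_trans t0); apply/ltW; near: s; exact: nbhs_right_gt.
exact: (cvg_comp _ _ (@cvg_addr_right t) (@path_rcont _ _ w (a + t))).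
Unshelve. all: by end_near. Qed.

Let shifted_llim t : cvg (shifted s @[s --> t^'-]).
Proof.
have [t0|t0] := leP t 0.
  apply/cvg_ex; exists (shifted 0).
  apply: (@near_cvg _ _ (fun=> shifted 0)); last exact: cvg_cst.
  near=> s; rewrite [RHS]shifted_neg //.
  by apply: lt_le_trans t0; near: s; exact: nbhs_left_lt.
have /cvg_ex[l hl] := @path_llim _ _ w (a + t).
apply/cvg_ex; exists l.
apply: (@near_cvg _ _ (w \o +%R a)).
  near=> s; rewrite /= /shifted max_r //.
  by near: s; exact: nbhs_left_ge.
exact: (cvg_comp _ _ (@cvg_addr_left t) hl).
Unshelve. all: by end_near. Qed.

(* the path (w_{a+s})_{s >= 0}, for a >= 0 *)
Definition shift_path : cadlag_path R d :=
  CadlagPath shifted_rcont shifted_llim shifted_neg.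

End shift.

Section local_pattern.
Variable d : nat.

Record local_pattern := LocalPattern {
  pattern_set :> set (config d) ;
  pattern_local : exists F : seq 'rV[int]_d, forall eta xi : config d,
    {in F, eta =1 xi} -> pattern_set eta -> pattern_set xi }.

Lemma measurable_coord (x : 'rV[int]_d) (b : bool) :
  measurable [set eta : config d | eta x = b].
Proof.
have mt : measurable [set eta : config d | eta x].
  by apply: sub_sigma_algebra; exists x.
case: b => //.
rewrite (_ : [set _ | _] = ~` [set eta : config d | eta x]).
  exact: measurableC.
by apply/seteqP; split => eta /= ; [move=> ->|move/negP/negbTE].
Qed.

Lemma measurable_pattern (A : local_pattern) : measurable (A : set (config d)).
Proof.
case: A => A [F HF] /=.
have mF (b : seq bool) : measurable [set eta : config d | map eta F = b].
  elim: F b {HF} => [|x F IH] [|c b] /=.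
  - by rewrite (_ : [set _ | _] = setT) //; apply/seteqP; split.
  - by rewrite (_ : [set _ | _] = set0) //; apply/seteqP; split.
  - by rewrite (_ : [set _ | _] = set0) //; apply/seteqP; split.
  - rewrite (_ : [set _ | _] = [set eta : config d | eta x = c] `&`
                               [set eta : config d | map eta F = b]).
      by apply: measurableI; [exact: measurable_coord|exact: IH].
    by apply/seteqP; split => eta /= => [[-> ->]|[-> ->]].
rewrite (_ : A = \bigcup_(b in setT)
   ([set eta : config d | map eta F = b] `&`
    [set eta | exists2 xi, A xi & map xi F = b])).
  apply: countable_bigcupT_measurable => [|b]; first exact: countableP.
  have [h|h] := pselect (exists2 xi, A xi & map xi F = b).
    rewrite (_ : _ `&` _ = [set eta : config d | map eta F = b]) //.
    by apply/seteqP; split => // eta [].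
  rewrite (_ : _ `&` _ = set0) //.
  by apply/seteqP; split => // eta [].
apply/seteqP; split => [eta Aeta|eta [b _ [/= eb [xi Axi xb]]]].
  by exists (map eta F) => //; split => //; exists eta.
by apply: HF Axi; apply/eq_in_map; rewrite eb.
Qed.

Variable R : realType.

Lemma path_pattern_right (w : cadlag_path R d) (A : local_pattern) t :
  \forall s \near t^'+, pattern_set A (w t) <-> pattern_set A (w s).
Proof.
case: A => A [F HF] /=.
have hF : \forall s \near t^'+, {in F, w s =1 w t}.
  elim: F {HF} => [|x F IH]; first by apply: nearW => s y; rewrite in_nil.
  have wx : \forall s \near t^'+, w s x = w t x.
    have : w s x @[s --> t^'+] --> w t x.
      exact: (cvg_comp _ _ (@path_rcont _ _ w t)
        (@proj_continuous _ (fun=> bool) x (w t))).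
    by move=> /(_ [set w t x]); apply; rewrite nbhs_principalE.
  near=> s => y; rewrite in_cons => /orP[/eqP->|].
    by near: s.
  by apply: (near IH s).
near=> s; have ws : {in F, w s =1 w t} by near: s.
by split; apply: HF => x xF; rewrite ws.
Unshelve. all: by end_near. Qed.

Local Open Scope ereal_scope.

Definition hitting_time (A : set (config d)) (w : cadlag_path R d) : \bar R :=
  ereal_inf [set t%:E | t in [set t | (0 <= t)%R /\ A (w t)]].

(* the event {tau > t} *)
Definition survival (A : set (config d)) (t : R) : set (cadlag_path R d) :=
  [set w | t%:E < hitting_time A w].

Lemma survivalP (A : local_pattern) t (w : cadlag_path R d) :
  survival A t w <-> (forall s, (0 <= s <= t)%R -> ~ pattern_set A (w s)).
Proof.
split => [tw s /andP[s0 st] Aws|nA].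
  move: tw; rewrite /survival /= ltNge => /negP; apply.
  apply: (@le_trans _ _ s%:E); last by rewrite lee_fin.
  by apply: ereal_inf_lbound; exists s.
rewrite /survival /= ltNge; apply/negP => tau_t.
have tau0 : 0 <= hitting_time A w.
  by apply: le_ereal_inf_tmp => _ [s [s0 _] <-]; rewrite lee_fin.
have tauf : hitting_time A w \is a fin_num.
  by rewrite ge0_fin_numE // (le_lt_trans tau_t) // ltry.
have [h hE] : exists h, hitting_time A w = h%:E.
  by exists (fine (hitting_time A w)); rewrite fineK.
move: tau0 tau_t; rewrite hE !lee_fin => h0 ht.
have nAh : ~ pattern_set A (w h) by apply: nA; rewrite h0 ht.
have /nbhs_right0P[e /= e0 He] := path_pattern_right w A h.
have [_ [s [s0 As] <-]] :=
  @lb_ereal_inf_adherent _ _ e e0 tauf.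
rewrite -/(hitting_time A w) hE lte_fin => she.
have hs : (h <= s)%R.
  by rewrite -lee_fin -hE; apply: ereal_inf_lbound; exists s.
have [sh|sh] := eqVneq s h; first by apply: nAh; rewrite -sh.
have dist : (`|0 - (s - h)| < e)%R.
  by rewrite sub0r normrN ger0_norm ?subr_ge0 // ltrBlDr addrC.
have sh0 : (0 < s - h)%R by rewrite subr_gt0 lt_neqAle eq_sym sh.
by apply: nAh; have [_] := He _ dist sh0; rewrite addrC subrK; apply.
Qed.

Lemma measurable_eval (B : set (config d)) (s : R) : (0 <= s)%R ->
  measurable B -> measurable [set w : cadlag_path R d | B (w s)].
Proof.
move=> s0 mB; apply: sub_sigma_algebra; exists s.
by rewrite /= in_itv /= andbT; split => //; exists B.
Qed.

Lemma measurable_survival (A : local_pattern) t : measurable (survival A t).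
Proof.
have mA := measurable_pattern A.
have [t0|t0] := ltP t 0%R.
  rewrite (_ : survival A t = setT) //; apply/seteqP; split=> // w _.
  by apply/survivalP => s /andP[s0 st]; move: (le_trans s0 st); rewrite leNgt t0.
have -> : survival A t = ~` ([set w : cadlag_path R d | pattern_set A (w t)] `|`
    \bigcup_(q in setT) (if (0 <= (ratr q : R) < t)%R
       then [set w : cadlag_path R d | pattern_set A (w (ratr q : R))] else set0)).
  apply/seteqP; split => w.
    move/survivalP => nA [|[q _]] /=; first by apply: nA; rewrite t0 lexx.
    case: ifPn => // /andP[q0 qt]; apply: nA.
    by rewrite q0 ltW.
  move=> /= h; apply/survivalP => s /andP[s0 st] As; apply: h.
  have [ts|ts] := eqVneq s t; first by left; rewrite -ts.
  right; have {}st : (s < t)%R by rewrite lt_neqAle ts.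
  have /nbhs_right0P[e /= e0 He] := path_pattern_right w A s.
  have /rat_in_itvoo[q] : (s < Num.min t (s + e))%R by rewrite lt_min st ltrDl.
  rewrite in_itv /= lt_min => /andP[sq /andP[qt qe]].
  exists q => //; rewrite (le_trans s0 (ltW sq)) qt /=.
  have sq0 : (0 < ratr q - s)%R by rewrite subr_gt0.
  have dist : (`|0 - (ratr q - s)| < e)%R.
    by rewrite sub0r normrN gtr0_norm // ltrBlDr addrC.
  by have [+ _] := He _ dist sq0; rewrite addrC subrK; apply.
apply/measurableC/measurableU; first exact: measurable_eval.
apply: countable_bigcupT_measurable => [|q]; first exact: countableP.
by case: ifPn => // /andP[q0 _]; exact: measurable_eval.
Qed.

Definition path_eval (t : R) (w : cadlag_path R d) : config d := w t.

Let measurable_path_eval t : measurable_fun setT (path_eval t).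
Proof.
move=> _ B mB; rewrite setTI.
have [t0|t0] := leP 0%R t; first exact: measurable_eval.
rewrite (_ : _ @^-1` _ = [set w : cadlag_path R d | B (w 0%R)]).
  exact: measurable_eval.
by apply/seteqP; split => w; rewrite /path_eval /= path_neg.
Qed.

HB.instance Definition _ t :=
  isMeasurableFun.Build _ _ _ _ (path_eval t) (measurable_path_eval t).

End local_pattern.

Section markov_process.
Local Open Scope ereal_scope.
Variables (R : realType) (d : nat).
Notation path := (cadlag_path R d).
Variable P : R.-pker (config d) ~> (cadlag_path R d).

Definition markov_process : Prop :=
  (forall eta, P eta [set w | w 0%R = eta] = 1) /\
  (forall eta s B G, (0 <= s)%R -> history s B -> measurable G ->
    P eta (B `&` [set w | G (shift_path s w)]) = \int[P eta]_(w in B) P (w s) G).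

(* E_eta [f (eta_t)] *)
Definition semigroup (t : R) (f : config d -> R) (eta : config d) : R :=
  (\int[P eta]_w f (w t))%R.

(* E_eta [f (eta_t) 1_{tau > t}] *)
Definition killed_semigroup (A : set (config d)) (t : R) (f : config d -> R)
    (eta : config d) : \bar R :=
  \int[P eta]_(w in survival A t) (f (w t))%:E.

Section initial_law.
Variable nu : probability (config d) R.

Definition invariant_law : Prop := forall t B, (0 <= t)%R -> measurable B ->
  \int[nu]_eta P eta [set w | B (w t)] = nu B.

Definition path_law (G : set path) : \bar R := \int[nu]_eta P eta G.

Let path_law0 : path_law set0 = 0.
Proof. by rewrite /path_law integral0_eq. Qed.

Let path_law_ge0 G : 0 <= path_law G. Proof. exact: integral_ge0. Qed.

Let path_law_sigma_additive : semi_sigma_additive path_law.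
Proof.
move=> U mU tU mUU; rewrite [X in _ --> X](_ : _ =
  \int[nu]_eta (\sum_(n <oo) P eta (U n))); last first.
  apply: eq_integral => V _.
  by apply/esym/cvg_lim => //; exact/measure_semi_sigma_additive.
apply/cvg_closeP; split.
  by apply: is_cvg_nneseries => n _ _; exact: integral_ge0.
rewrite closeE// integral_nneseries// => n.
exact: (measurable_kernel P _ (mU n)).
Qed.

HB.instance Definition _ := isMeasure.Build _ _ _ path_law
  path_law0 path_law_ge0 path_law_sigma_additive.

Let path_law_setT : path_law setT = 1.
Proof.
rewrite /path_law (eq_integral (cst 1)); last by move=> eta _; exact: prob_kernel.
by rewrite integral_cst // mul1e; exact: probability_setT.
Qed.

HB.instance Definition _ := Measure_isProbability.Build _ _ _ path_law
  path_law_setT.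

(* (f, g) is in the graph of the generator of the semigroup in L^2(nu) *)
Definition generator (f g : config d -> R) : Prop :=
  [/\ f \in Lfun nu 2%:E, g \in Lfun nu 2%:E &
    'N[nu]_2%:E [(fun eta => ((semigroup h f eta - f eta) / h - g eta)%:E)]
      @[h --> 0^'+] --> 0].

Section conditioning.
Variables (A : local_pattern d) (t : R).

(* The law of the process started from nu, conditioned on {tau > t}; the second
   argument of mnormalize is a default value used only if {tau > t} is null. *)
Definition cond_path_law : probability path R :=
  mnormalize (mrestr path_law (measurable_survival A t)) path_law.

Definition cond_law : probability (config d) R :=
  distribution cond_path_law (path_eval t).

End conditioning.

(* Weak convergence of T_t(nu): Omega is compact, so that continuous functions
   are bounded. *)
Definition is_yaglom_limit (A : local_pattern d)
    (mu : probability (config d) R) : Prop :=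
  forall f : config d -> R, continuous f ->
    (\int[cond_law A t]_eta (f eta)%:E) @[t --> +oo%R] -->
      \int[mu]_eta (f eta)%:E.

Definition is_decay_rate (A : set (config d)) (lambda : R) : Prop :=
  ((- (t^-1 * ln (fine (path_law (survival A t)))))%R @[t --> +oo%R] --> lambda).

(* For t = 0 this says that f vanishes nu-a.s. on A. *)
Definition is_eigenfunction (A : set (config d)) (lambda : R)
    (f : config d -> R) : Prop :=
  forall t, (0 <= t)%R -> {ae nu, forall eta,
    killed_semigroup A t f eta = (expR (- (lambda * t)) * f eta)%:E}.

Definition is_simple_eigenfunction (A : set (config d)) (lambda : R)
    (u : config d -> R) : Prop :=
  [/\ u \in Lfun nu 2%:E, ~ {ae nu, forall eta, u eta = 0%R},
      is_eigenfunction A lambda u &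
      forall v, v \in Lfun nu 2%:E -> is_eigenfunction A lambda v ->
        exists c, {ae nu, forall eta, v eta = (c * u eta)%R}].

End initial_law.

End markov_process.

Section L2.
Local Open Scope ereal_scope.
Context {disp} {T : measurableType disp} {R : realType}.
Variable nu : {measure set T -> \bar R}.

Definition is_density (mu : set T -> \bar R) (f : T -> R) : Prop :=
  forall B, measurable B -> mu B = \int[nu]_(x in B) (f x)%:E.

Variable G : (T -> R) -> (T -> R) -> Prop.

Definition adjoint (f g : T -> R) : Prop :=
  [/\ f \in Lfun nu 2%:E, g \in Lfun nu 2%:E & forall p q, G p q ->
    (\int[nu]_x (q x * f x) = \int[nu]_x (p x * g x))%R].

(* self-adjointness of the (unbounded) operator of L^2(nu) with graph G *)
Definition self_adjoint : Prop :=
  (forall f, f \in Lfun nu 2%:E -> forall e, (0 < e)%R ->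
    exists p q, G p q /\ 'N[nu]_2%:E [(fun x => (f x - p x)%:E)] < e%:E) /\
  (forall f g, G f g <-> adjoint f g).

End L2.

Section doob_transform.
Local Open Scope ereal_scope.
Context {disp} {T : measurableType disp} {R : realType}.
Variables (nu : probability T R) (u : {mfun T >-> R}).

Definition square_measure (B : set T) : \bar R :=
  \int[nu]_(x in B) (u x ^+ 2)%:E.

Let square_measure0 : square_measure set0 = 0.
Proof. exact: integral_set0. Qed.

Let square_measure_ge0 B : 0 <= square_measure B.
Proof. by apply: integral_ge0 => x _; rewrite lee_fin sqr_ge0. Qed.

Let square_measure_sigma_additive : semi_sigma_additive square_measure.
Proof.
apply: semi_sigma_additive_nng_induced => [|x]; last by rewrite lee_fin sqr_ge0.
exact/measurable_EFinP/measurable_funX.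
Qed.

HB.instance Definition _ := isMeasure.Build _ _ _ square_measure
  square_measure0 square_measure_ge0 square_measure_sigma_additive.

(* d hat mu = u^2 d nu / int u^2 d nu; the default value nu of mnormalize is
   used only if the integral is 0 or +oo *)
Definition normalized_square : probability T R := mnormalize square_measure nu.

End doob_transform.

(* Pu is the kernel xi |-> P^u_xi. Since u is only determined up to a nu-null
   set, so is, for each t, the right-hand side below as a function of xi: the
   exceptional null set may depend on t. *)
Definition is_doob_transform (R : realType) (d : nat)
    (P : R.-pker (config d) ~> (cadlag_path R d))
    (nu : probability (config d) R) (A : set (config d)) (lambda : R)
    (u : {mfun config d >-> R})
    (Pu : R.-pker (config d) ~> (cadlag_path R d)) : Prop :=
  forall t, (0 <= t)%R -> {ae normalized_square nu u, forall xi,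
    forall Gamma, history t Gamma ->
      (Pu xi Gamma = (u xi)^-1%:E *
        \int[P xi]_w (\1_Gamma w * u (w t) * expR (lambda * t)
                       * \1_(survival A t) w)%:E)%E}.

(* Main.v *)
Require Import Defs.
From mathcomp Require Import all_boot all_order all_algebra.
From mathcomp Require Import all_classical all_reals all_analysis.
From mathcomp Require Import measurable_realfun ring.

(* Let Q be the law of the process started from nu, S_t its semigroup, and
   Z_t = Q(tau > t).
   - S_t is symmetric in L^2(nu). For f and g in the domain of the generator,
     <f, S_t g> - <S_t f, g> is telescoped along the grid of step h = t / n;
     each step costs h times (|f| e_h(g) + e_h(f) |g|), where e_h is the norm of
     the error of the difference quotient at scale h, which vanishes with h; the
     general case follows by density.
   - Hence the killed chain along a dyadic grid is symmetric and, by right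
     continuity, so is the killed semigroup. Therefore P_eta(tau > t), which is
     the density of Q(tau > t, eta_t in .), is nu-a.s. equal to Z_t g_t(eta).
   - By the Markov property at times a and a + r, with s = t - a - r, the
     conditioned expectation of phi is
       (Z_a Z_s / Z_t) E_Q[g_a(eta_0) phi 1_{tau > r} g_s(eta_r)].
     The constant is eliminated with phi = 1, and the limit of the expectation
     is obtained from the convergence in L^2 of g_a and g_s to u.
   - The limiting law has density proportional to u(eta_0) 1_{tau > r} u(eta_r)
     with respect to Q on the events before time r. *)

Set Implicit Arguments.
Unset Strict Implicit.
Unset Printing Implicit Defensive.

Import Order.TTheory GRing.Theory Num.Theory.
Import numFieldNormedType.Exports.

Local Open Scope classical_set_scope.
Local Open Scope ring_scope.

(** * Integration and square-integrable functions *)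

Section mixture.
Local Open Scope ereal_scope.
Import HBNNSimple.
Context d1 d2 (Y : measurableType d1) (Z : measurableType d2) (R : realType).
Variables (m : {measure set Z -> \bar R}) (mu : {measure set Y -> \bar R}).
Variable k : Y -> {measure set Z -> \bar R}.
Hypothesis mk : forall U, measurable U -> measurable_fun [set: Y] (k ^~ U).
Hypothesis mE : forall U, measurable U -> m U = \int[mu]_y k y U.

Let integral_mixture_nnsfun (f : {nnsfun Z >-> R}) :
  \int[m]_z (f z)%:E = \int[mu]_y \int[k y]_z (f z)%:E.
Proof.
have sE (n : {measure set Z -> \bar R}) :
    \int[n]_z (f z)%:E = \sum_(x \in range f) x%:E * n (f @^-1` [set x]).
  by rewrite integralT_nnsfun sintegralE.
rewrite sE; under [RHS]eq_integral do rewrite sE.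
have x0 x y : 0 <= x%:E * k y (f @^-1` [set x]).
  (* A negative [x] is not a value of [f]: its preimage is empty and the term vanishes. *)
  have [?|x0] := leP 0%R x; first by rewrite mule_ge0.
  by rewrite preimage_nnfun0// measure0 mule0.
rewrite ge0_integral_fsum//; last first.
  by move=> x; apply: measurable_funeM; exact: mk.
apply: eq_fsbigr => x _; rewrite mE//.
have [?|x_lt0] := leP 0%R x; first by rewrite ge0_integralZl_EFin//; exact: mk.
rewrite preimage_nnfun0// integral0_eq ?mule0 ?integral0_eq// => y _.
by rewrite measure0 mule0.
Qed.

(** Linearity gives the case of simple functions, and monotone convergence, in [z] and then in [y],
    the general one. The kernels used below are [P], the conditional laws of a shifted path, and
    weighted Dirac masses. *)
Lemma integral_mixture (f : Z -> \bar R) : (forall z, 0 <= f z) ->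
  measurable_fun [set: Z] f -> \int[m]_z f z = \int[mu]_y \int[k y]_z f z.
Proof.
move=> f0 mf; pose f_ := nnsfun_approx measurableT mf.
have mf_ n : measurable_fun [set: Z] (EFin \o f_ n) by exact/measurable_EFinP.
have f_0 n z : 0 <= (f_ n z)%:E by rewrite lee_fin.
have f_nd z : nondecreasing_seq (fun n => (f_ n z)%:E).
  by move=> a b ab; rewrite lee_fin; exact/lefP/nd_nnsfun_approx.
have f_lim (n : {measure set Z -> \bar R}) :
    \int[n]_z f z = limn (fun j => \int[n]_z (f_ j z)%:E).
  rewrite -monotone_convergence//; apply: eq_integral => z _.
  by apply/esym/cvg_lim => //; exact: cvg_nnsfun_approx.
rewrite f_lim; under [RHS]eq_integral do rewrite f_lim.
rewrite monotone_convergence//.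
- by congr (limn _); apply/funext => n; exact: integral_mixture_nnsfun.
- by move=> n; apply: measurable_fun_integral_kernel; [exact: mk| |exact: mf_].
- by move=> n y _; exact: integral_ge0.
- move=> y _ a b ab; apply: ge0_le_integral => //; [exact: mf_|exact: mf_|].
  by move=> z _; exact: f_nd.
Qed.

End mixture.

Section Lfun2.
Context d (T : measurableType d) (R : realType).
Variable mu : {measure set T -> \bar R}.
Local Open Scope ereal_scope.

Lemma Lfun_measurable p (f : T -> R) : f \in Lfun mu p ->
  measurable_fun [set: T] f.
Proof. by rewrite inE => /andP[]; rewrite inE. Qed.

Lemma Lnorm2E (f : T -> R) :
  'N[mu]_2%:E[EFin \o f] = (\int[mu]_x (f x ^+ 2)%:E) `^ 2^-1.
Proof.
rewrite unlock; congr (_ `^ _); apply: eq_integral => x _ /=.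
by rewrite powR_mulrn// -normrX ger0_norm// sqr_ge0.
Qed.

Lemma Lfun2P (f : T -> R) : f \in Lfun mu 2%:E <->
  measurable_fun [set: T] f /\ \int[mu]_x (f x ^+ 2)%:E < +oo.
Proof.
split=> [fL|[mf fy]].
  split; first exact: Lfun_measurable fL.
  have /integrableP[_] := Lfun2_integrable_sqr fL.
  apply: le_lt_trans; apply: ge0_le_integral => //.
  - by move=> x _; rewrite lee_fin sqr_ge0.
  - by apply/measurable_EFinP/measurable_funX; exact: Lfun_measurable fL.
  - apply: measurableT_comp => //.
    by apply/measurable_EFinP/measurable_funX; exact: Lfun_measurable fL.
  - by move=> x _ /=; rewrite lee_fin ler_norm.
rewrite inE; apply/andP; split; rewrite inE//=.
by rewrite /finite_norm Lnorm2E poweR_lty.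
Qed.

(** Real-valued norm; [fine] sends an infinite norm to 0, so it is meaningful only on
    [Lfun mu 2%:E]. *)
Definition norm2 (f : T -> R) : R := fine 'N[mu]_2%:E[EFin \o f].

Definition dot (f g : T -> R) : R := (\int[mu]_x (f x * g x))%R.

Lemma norm2E (f : T -> R) : f \in Lfun mu 2%:E ->
  (norm2 f)%:E = 'N[mu]_2%:E[EFin \o f].
Proof.
rewrite inE => /andP[_]; rewrite inE/= => fy.
by rewrite /norm2 fineK// ge0_fin_numE// Lnorm_ge0.
Qed.

Lemma norm2_sqrt (f : T -> R) : f \in Lfun mu 2%:E ->
  norm2 f = Num.sqrt (fine (\int[mu]_x (f x ^+ 2)%:E)).
Proof.
move=> /Lfun2P[_ fy]; rewrite /norm2 Lnorm2E.
have i0 : 0 <= \int[mu]_x (f x ^+ 2)%:E.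
  by apply: integral_ge0 => x _; rewrite lee_fin sqr_ge0.
have /fineK <- : \int[mu]_x (f x ^+ 2)%:E \is a fin_num.
  by rewrite ge0_fin_numE.
by rewrite poweR_EFin powR12_sqrt// fine_ge0.
Qed.

Lemma norm2_ge0 (f : T -> R) : (0 <= norm2 f)%R.
Proof. by rewrite /norm2 fine_ge0// Lnorm_ge0. Qed.

Lemma dotC (f g : T -> R) : dot f g = dot g f.
Proof. by apply: eq_Rintegral => x _; rewrite mulrC. Qed.

Lemma Lfun2_mul_integrable (f g : T -> R) : f \in Lfun mu 2%:E ->
  g \in Lfun mu 2%:E -> mu.-integrable setT (fun x => (f x * g x)%:E).
Proof. by move=> fL gL; apply/Lfun1_integrable; exact: Lfun2_mul_Lfun1. Qed.

Lemma Lfun2D (f g : T -> R) : f \in Lfun mu 2%:E -> g \in Lfun mu 2%:E ->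
  (fun x => f x + g x)%R \in Lfun mu 2%:E.
Proof.
by move=> fL gL; exact: (@Lfun_addr_closed _ _ _ mu 2%:E (lee1n 2)).2.
Qed.

Lemma Lfun2Z c (f : T -> R) : f \in Lfun mu 2%:E ->
  (fun x => c * f x)%R \in Lfun mu 2%:E.
Proof.
move=> fL; rewrite (_ : (fun _ => _) = c \o* f)%R; last first.
  by apply/funext => x /=; rewrite mulrC.
by apply: Lfun_scale => //; rewrite ler1n.
Qed.

Lemma norm2Z c (f : T -> R) : f \in Lfun mu 2%:E ->
  (norm2 (fun x => c * f x) = `|c| * norm2 f)%R.
Proof.
move=> fL; rewrite !norm2_sqrt//; last exact: Lfun2Z.
have -> : \int[mu]_x ((c * f x) ^+ 2)%:E =
    (c ^+ 2)%:E * \int[mu]_x (f x ^+ 2)%:E.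
  rewrite -ge0_integralZl_EFin ?sqr_ge0//.
  - by apply: eq_integral => x _; rewrite exprMn EFinM.
  - by move=> x _; rewrite lee_fin sqr_ge0.
  - by apply/measurable_EFinP/measurable_funX; exact: Lfun_measurable fL.
have /Lfun2P[_ fy] := fL.
have i0 : 0 <= \int[mu]_x (f x ^+ 2)%:E.
  by apply: integral_ge0 => x _; rewrite lee_fin sqr_ge0.
by rewrite fineM// ?ge0_fin_numE//= sqrtrM ?sqr_ge0// sqrtr_sqr.
Qed.

Lemma Lfun2B (f g : T -> R) : f \in Lfun mu 2%:E -> g \in Lfun mu 2%:E ->
  (fun x => f x - g x)%R \in Lfun mu 2%:E.
Proof.
move=> fL gL; rewrite (_ : (fun _ => _) = (fun x => f x + -1 * g x)%R).
  by apply: Lfun2D => //; exact: Lfun2Z.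
by apply/funext => x; rewrite mulN1r.
Qed.

Lemma dotDl (f g h : T -> R) : f \in Lfun mu 2%:E -> g \in Lfun mu 2%:E ->
  h \in Lfun mu 2%:E -> (dot (fun x => f x + g x) h = dot f h + dot g h)%R.
Proof.
move=> fL gL hL; rewrite /dot -RintegralD//; try exact: Lfun2_mul_integrable.
by apply: eq_Rintegral => x _; rewrite mulrDl.
Qed.

Lemma dotZl c (f h : T -> R) : f \in Lfun mu 2%:E ->
  h \in Lfun mu 2%:E -> (dot (fun x => c * f x) h = c * dot f h)%R.
Proof.
move=> fL hL; rewrite /dot -RintegralZl//; last exact: Lfun2_mul_integrable.
by apply: eq_Rintegral => x _; rewrite mulrA.
Qed.

Lemma dotBl (f g h : T -> R) : f \in Lfun mu 2%:E -> g \in Lfun mu 2%:E ->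
  h \in Lfun mu 2%:E -> (dot (fun x => f x - g x) h = dot f h - dot g h)%R.
Proof.
move=> fL gL hL; rewrite /dot -RintegralB//; try exact: Lfun2_mul_integrable.
by apply: eq_Rintegral => x _; rewrite mulrBl.
Qed.

Lemma dotBr (f g h : T -> R) : f \in Lfun mu 2%:E -> g \in Lfun mu 2%:E ->
  h \in Lfun mu 2%:E -> (dot h (fun x => f x - g x) = dot h f - dot h g)%R.
Proof. by move=> ? ? ?; rewrite dotC dotBl// !(dotC h). Qed.

Lemma eq_dotl (f f' g : T -> R) : measurable_fun setT f ->
  measurable_fun setT f' -> measurable_fun setT g ->
  {ae mu, forall x, f x = f' x} -> dot f g = dot f' g.
Proof.
move=> mf mf' mg ff'; congr fine; apply: ae_eq_integral => //.
- by apply/measurable_EFinP; exact: measurable_funM.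
- by apply/measurable_EFinP; exact: measurable_funM.
- by apply: filterS ff' => x -> _.
Qed.

Lemma eq_dotr (f g g' : T -> R) : measurable_fun setT f ->
  measurable_fun setT g -> measurable_fun setT g' ->
  {ae mu, forall x, g x = g' x} -> dot f g = dot f g'.
Proof. by move=> *; rewrite dotC [RHS]dotC; exact: eq_dotl. Qed.

Lemma eq_norm2 (f f' : T -> R) : measurable_fun setT f ->
  measurable_fun setT f' -> {ae mu, forall x, f x = f' x} ->
  norm2 f = norm2 f'.
Proof.
move=> mf mf' ff'; rewrite /norm2 !Lnorm2E; congr (fine (_ `^ _)).
apply: ae_eq_integral => //.
- by apply/measurable_EFinP; exact: measurable_funX.
- by apply/measurable_EFinP; exact: measurable_funX.
- by apply: filterS ff' => x -> _.
Qed.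

(** Hölder's inequality with both exponents equal to 2. *)
Lemma ler_norm_dot (f g : T -> R) : f \in Lfun mu 2%:E ->
  g \in Lfun mu 2%:E -> (`|dot f g| <= norm2 f * norm2 g)%R.
Proof.
move=> fL gL; have [mf mg] := (Lfun_measurable fL, Lfun_measurable gL).
rewrite -lee_fin EFinM !norm2E//.
apply: (@le_trans _ _ 'N[mu]_1[EFin \o (f \* g)%R]); last first.
  by apply: hoelder => //; rewrite [RHS]splitr !div1r.
rewrite EFin_normr_Rintegral//; last exact: Lfun2_mul_integrable.
rewrite Lnorm1; apply: le_abse_integral => //.
by apply/measurable_EFinP; exact: measurable_funM.
Qed.

Lemma ler_norm2D (f g : T -> R) : f \in Lfun mu 2%:E ->
  g \in Lfun mu 2%:E -> (norm2 (fun x => f x + g x) <= norm2 f + norm2 g)%R.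
Proof.
move=> fL gL; have [mf mg] := (Lfun_measurable fL, Lfun_measurable gL).
rewrite -lee_fin EFinD !norm2E//; last exact: Lfun2D.
by apply: minkowski_EFin => //; rewrite ler1n.
Qed.

End Lfun2.

Lemma le_norm2 d d' (T : measurableType d) (T' : measurableType d')
    (R : realType) (mu : {measure set T -> \bar R})
    (mu' : {measure set T' -> \bar R}) (f : T -> R) (f' : T' -> R) :
  f \in Lfun mu 2%:E -> f' \in Lfun mu' 2%:E ->
  (\int[mu]_x (f x ^+ 2)%:E <= \int[mu']_x (f' x ^+ 2)%:E)%E ->
  norm2 mu f <= norm2 mu' f'.
Proof.
move=> fL f'L ff'; rewrite -lee_fin !norm2E// !Lnorm2E.
have i0 d1 (T1 : measurableType d1) (n : {measure set T1 -> \bar R}) h :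
    (0 <= \int[n]_x (h x ^+ 2)%:E)%E.
  by apply: integral_ge0 => x _; rewrite lee_fin sqr_ge0.
by apply: gt0_ler_poweR => //; rewrite in_itv/= leey i0.
Qed.

(* Jensen's inequality, also when the right-hand side is infinite. *)
Lemma le_sqr_Rintegral d (T : measurableType d) (R : realType)
    (P : {measure set T -> \bar R}) (f : T -> R) :
  P [set: T] = 1%E -> measurable_fun [set: T] f ->
  (((\int[P]_x f x) ^+ 2)%:E <= \int[P]_x (f x ^+ 2)%:E)%E.
Proof.
move=> PT mf; have [fy|] := ltP (\int[P]_x (f x ^+ 2)%:E)%E +oo%E; last first.
  by rewrite leye_eq => /eqP ->; rewrite leey.
have fL : f \in Lfun P 2%:E by apply/Lfun2P.
(* Jensen is Cauchy-Schwarz against the constant 1, which has norm 1 for a probability. *)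
have int1 : (\int[P]_x (cst 1 x ^+ 2)%:E = 1)%E.
  rewrite (eq_integral (cst 1%E)); last by move=> x _; rewrite /= expr1n.
  by rewrite integral_cst// mul1e.
have oneL : (cst 1 : T -> R) \in Lfun P 2%:E.
  by apply/Lfun2P; rewrite int1 ltry; split => //; exact: measurable_cst.
have n1 : norm2 P (cst 1) = 1.
  by rewrite /norm2 Lnorm2E int1 poweR1r.
have := ler_norm_dot fL oneL; rewrite n1 mulr1 => H.
have -> : (\int[P]_x f x) = dot P f (cst 1).
  by apply: eq_Rintegral => x _; rewrite mulr1.
have n2 : ((norm2 P f ^+ 2)%:E = \int[P]_x (f x ^+ 2)%:E)%E.
  have i0 : (0 <= \int[P]_x (f x ^+ 2)%:E)%E.
    by apply: integral_ge0 => x _; rewrite lee_fin sqr_ge0.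
  by rewrite norm2_sqrt// sqr_sqrtr ?fine_ge0// fineK// ge0_fin_numE.
rewrite -n2 lee_fin -(ger0_norm (sqr_ge0 (dot _ _ _))) normrX.
by rewrite lerXn2r// ?nnegrE// norm2_ge0.
Qed.

(** * Change of variables through densities *)

Section transfer.
Local Open Scope ereal_scope.
Context d1 d2 d3 (X : measurableType d1) (Y : measurableType d2)
  (Z : measurableType d3) (R : realType).
Variables (m : {measure set X -> \bar R}) (m' : {measure set Y -> \bar R}).
Variables (psi : X -> Z) (phi : Y -> Z) (rho : Y -> R) (f : Z -> \bar R).
Hypothesis mpsi : measurable_fun setT psi.
Hypothesis mphi : measurable_fun setT phi.
Hypothesis rho0 : forall y, (0 <= rho y)%R.
Hypothesis mrho : measurable_fun setT rho.
Hypothesis mm' : forall B, measurable B ->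
  m (psi @^-1` B) = \int[m']_(y in phi @^-1` B) (rho y)%:E.

Hypothesis f0 : forall z, 0 <= f z.
Hypothesis mf : measurable_fun setT f.

(* With phi real-valued, only the events of the sigma-algebra generated by phi
   have to be compared in order to integrate phi. *)
Lemma ge0_integral_image_density :
  \int[m]_x f (psi x) = \int[m']_y (f (phi y) * (rho y)%:E).
Proof.
pose psi' := mfun_Sub (mem_set mpsi).
(* The image of [m] under [psi] is the mixture over [m'] of the Dirac masses at [phi y] with weights
   [rho y]. *)
rewrite -[LHS](@ge0_integral_pushforward _ _ _ _ _ _ mpsi m setT f)//.
rewrite (integral_mixture (m := pushforward m psi') (mu := m')
  (k := fun y => mscale (NngNum (rho0 y)) (dirac (phi y))))//.
- apply: eq_integral => y _; rewrite ge0_integral_mscale//.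
  by rewrite integral_dirac//= diracT mul1e muleC.
- move=> U mU; apply: emeasurable_funM; first exact/measurable_EFinP.
  by apply/measurable_EFinP; exact: measurableT_comp (measurable_indic _) mphi.
- move=> U mU; transitivity (m (psi @^-1` U)) => //; rewrite mm'// integral_mkcond.
  apply: eq_integral => y _.
  transitivity ((rho y)%:E * \d_(phi y) U)%E => //.
  rewrite diracE /patch (_ : (y \in phi @^-1` U) = (phi y \in U)); last first.
    by apply/idP/idP; rewrite !inE.
  by case: ifP => _; rewrite ?mule1 ?mule0.
Qed.

End transfer.

Lemma ge0_integral_image d1 d2 (X : measurableType d1) (Y : measurableType d2)
    (R : realType) (m : {measure set X -> \bar R})
    (m' : {measure set Y -> \bar R}) (psi : X -> Y) (f : Y -> \bar R) :
  measurable_fun setT psi ->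
  (forall B, measurable B -> m (psi @^-1` B) = m' B) ->
  (forall y, 0 <= f y)%E -> measurable_fun setT f ->
  (\int[m]_x f (psi x) = \int[m']_y f y)%E.
Proof.
move=> mpsi mm' f0 mf.
rewrite (ge0_integral_image_density (m' := m') (phi := id) (rho := cst 1))//.
- by apply: eq_integral => y _; rewrite mule1.
- move=> B mB; rewrite mm'//; transitivity (\int[m']_(y in B) cst 1 y)%E => //.
  by rewrite integral_cst// mul1e.
Qed.

Section Lfun2_bounded.
Context d (T : measurableType d) (R : realType).
Variable mu : {measure set T -> \bar R}.

Lemma Lfun2_bounded_mul (b f : T -> R) M : 0 <= M -> measurable_fun setT b ->
  (forall x, `|b x| <= M) -> f \in Lfun mu 2%:E ->
  (fun x => b x * f x) \in Lfun mu 2%:E /\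
  norm2 mu (fun x => b x * f x) <= M * norm2 mu f.
Proof.
move=> M0 mb bM fL; have mf := Lfun_measurable fL.
have le_int : (\int[mu]_x ((b x * f x) ^+ 2)%:E <=
    \int[mu]_x ((M * f x) ^+ 2)%:E)%E.
  apply: ge0_le_integral => //.
  - by move=> x _; rewrite lee_fin sqr_ge0.
  - by apply/measurable_EFinP/measurable_funX; exact: measurable_funM.
  - by apply/measurable_EFinP/measurable_funX; exact: measurable_funM.
  - move=> x _; rewrite lee_fin !exprMn ler_wpM2r ?sqr_ge0//.
    by rewrite -(ger0_norm (sqr_ge0 (b x))) normrX lerXn2r.
have ML := Lfun2Z M fL.
have bL : (fun x => b x * f x) \in Lfun mu 2%:E.
  apply/Lfun2P; split; first exact: measurable_funM.
  by apply: le_lt_trans le_int _; have /Lfun2P[] := ML.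
by split => //; apply: (le_trans (le_norm2 bL ML le_int)); rewrite norm2Z// ger0_norm.
Qed.

End Lfun2_bounded.

(** * Paths and survival *)

Section paths.
Variables (R : realType) (d : nat).
Notation path := (cadlag_path R d).

Lemma measurable_path_at t : measurable_fun [set: path] (fun w => w t).
Proof. exact: (measurable_funP (@path_eval d R t)). Qed.

Lemma measurable_fun_path_at t (f : config d -> R) :
  measurable_fun setT f -> measurable_fun [set: path] (fun w => f (w t)).
Proof. by move=> mf; exact: measurableT_comp (measurable_path_at t). Qed.

Lemma measurable_shift_path a : 0 <= a ->
  measurable_fun setT (@shift_path R d a).
Proof.
move=> a0; apply: (measurability (evaluations `[0, +oo[)) => //.
move=> _ [_ [s [s0 [B [mB ->]]]] <-]; rewrite setTI.
have := measurable_path_at (a + Num.max 0 s) measurableT mB.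
by rewrite setTI.
Qed.

Lemma history_measurable_set t (G : set path) : history t G -> measurable G.
Proof.
apply: sub_sigma_algebra2 => _ [s [s0 [B [mB ->]]]].
exists s; split; last by exists B.
by move: s0; rewrite /= !in_itv/= => /andP[-> _].
Qed.

Lemma history_at t s (C : set (config d)) : 0 <= s <= t -> measurable C ->
  history t [set w : path | C (w s)].
Proof.
move=> st mC; apply: sub_sigma_algebra; exists s.
by split; [rewrite /= in_itv|exists C].
Qed.

Lemma historyI t (G H : set path) : history t G -> history t H ->
  history t (G `&` H).
Proof.
exact: (@measurableI _ (g_sigma_algebraType (evaluations `[0, t]))).
Qed.

Lemma historyT t : history t [set: path].
Proof.
exact: (@measurableT _ (g_sigma_algebraType (evaluations `[0, t]))).
Qed.

Lemma history_bigcap t (I : nat -> Prop) (G : nat -> set path) :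
  (forall n, I n -> history t (G n)) -> history t (\bigcap_(n in I) G n).
Proof.
exact: (@bigcap_measurableType _ (g_sigma_algebraType (evaluations `[0, t]))).
Qed.

(** The lattice is countable, so countably many coordinate events determine a configuration. *)
Lemma measurable_config1 (eta : config d) : measurable [set eta].
Proof.
rewrite (_ : [set eta] = ~` \bigcup_(x in setT) ~` [set xi | xi x = eta x]).
  apply/measurableC/countable_bigcupT_measurable => [|x]; first exact: countableP.
  by apply: measurableC; exact: measurable_coord.
rewrite setC_bigcup; apply/seteqP; split=> [xi -> x _ //|xi h].
  by rewrite setCK.
by apply/funext => x; have := h x I; rewrite setCK.
Qed.

Definition avoids (A : set (config d)) (n : nat) (h : R) : set path :=
  [set w | forall k, (k <= n)%N -> ~ A (w (k%:R * h))].

Lemma history_avoids (A : local_pattern d) n h : 0 <= h ->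
  history (n%:R * h) (avoids A n h).
Proof.
move=> h0; rewrite (_ : avoids _ _ _ = \bigcap_(k in [set k | (k <= n)%N])
  [set w : path | (~` pattern_set A) (w (k%:R * h))]) //.
apply: history_bigcap => k kn; apply: history_at.
  by rewrite mulr_ge0//= ler_wpM2r// ler_nat.
by apply: measurableC; exact: measurable_pattern.
Qed.

(** Powers of two make the successive grids of [0, t] nested, so these events decrease with [m]. *)
Definition dyadic_avoids (A : set (config d)) (t : R) (m : nat) : set path :=
  avoids A (2 ^ m) (t / (2 ^ m)%:R).

Lemma natr_exp2_neq0 m : (2 ^ m)%:R != 0 :> R.
Proof. by rewrite pnatr_eq0 expn_eq0. Qed.

Lemma history_dyadic_avoids (A : local_pattern d) t m : 0 <= t ->
  history t (dyadic_avoids A t m).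
Proof.
move=> t0; rewrite -[X in history X](divfK (natr_exp2_neq0 m)) mulrC.
by apply: history_avoids; rewrite divr_ge0.
Qed.

Lemma nonincreasing_dyadic_avoids (A : set (config d)) t :
  {homo dyadic_avoids A t : m n / (m <= n)%N >-> n `<=` m}.
Proof.
move=> m n mn w wn k km.
have nE : (2 ^ n = 2 ^ (n - m) * 2 ^ m)%N by rewrite -expnD subnK.
have := wn (k * 2 ^ (n - m))%N; rewrite nE mulnC leq_mul2l km orbT.
move=> /(_ isT); congr (~ A (w _)).
by rewrite !natrM; field; rewrite !natr_exp2_neq0.
Qed.

(* By right continuity, a path which visits A before time t is in A during a
   nontrivial time interval, hence at a dyadic time. *)
Lemma survival_bigcap (A : local_pattern d) t : 0 <= t ->
  survival A t = \bigcap_m dyadic_avoids A t m.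
Proof.
move=> t0; apply/seteqP; split => w.
  move=> /survivalP nA m _ k km; apply: nA.
  rewrite mulr_ge0 ?divr_ge0//= mulrCA ler_piMr//.
  by rewrite ler_pdivrMr ?ltr0n ?expn_gt0// mul1r ler_nat.
move=> nA; apply/survivalP => s /andP[s0 st] As.
(* The endpoint [t] is itself a grid time, already for [m = 0] and [k = 1]. *)
have [ts|ts] := eqVneq s t.
  apply: (nA 0 I 1%N) => //=.
  by rewrite expn0 divr1 mul1r -ts.
have {}st : (s < t)%R by rewrite lt_neqAle ts.
have tgt0 : 0 < t by apply: le_lt_trans st.
have /nbhs_right0P[e /= e0 He] := path_pattern_right w A s.
(* A grid time in ]s, s + e'[ is both close enough to [s] for the path to be in A and smaller than
   [t]. *)
pose e' := Num.min e (t - s).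
have e'0 : 0 < e' by rewrite lt_min e0 subr_gt0.
(* Since 2^m > m > t / e', the mesh t / 2^m is smaller than [e']. *)
pose m := (Num.truncn (t / e')).+1.
have mE : t / (2 ^ m)%:R < e'.
  rewrite ltr_pdivrMr ?ltr0n ?expn_gt0// mulrC -ltr_pdivrMr//.
  have /andP[_ ] := truncn_itv (divr_ge0 t0 (ltW e'0)).
  move=> /lt_trans; apply; rewrite ltr_nat -/m.
  exact: ltn_expl.
set h := t / _ in mE; have h0 : 0 < h by rewrite divr_gt0// ltr0n expn_gt0.
(* Index of the first grid time strictly after [s]; it lies at distance at most [h]. *)
pose k := (Num.truncn (s / h)).+1.
have /andP[k1 k2] := truncn_itv (divr_ge0 s0 (ltW h0)).
have skh : s < k%:R * h by rewrite -ltr_pdivrMr.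
have khs : k%:R * h <= s + h.
  by rewrite /k -natr1 mulrDl mul1r lerD2r -ler_pdivlMr.
have khe : k%:R * h < s + e' by apply: le_lt_trans khs _; rewrite ltrD2l.
apply: (nA m I k).
  have : k%:R * h < t.
    apply: (lt_le_trans khe); rewrite -lerBrDl.
    by rewrite /e' ge_min lexx orbT.
  by rewrite -ltr_pdivlMr// invf_div mulrCA divff ?gt_eqF// mulr1 ltr_nat => /ltnW.
have dist : (`|0 - (k%:R * h - s)| < e)%R.
  rewrite sub0r normrN gtr0_norm ?subr_gt0// ltrBlDr addrC.
  by apply: lt_le_trans khe _; rewrite lerD2l /e' ge_min lexx.
have sq0 : (0 < k%:R * h - s)%R by rewrite subr_gt0.
by have [+ _] := He _ dist sq0; rewrite addrC subrK; apply.
Qed.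

(** This allows the Markov property at time [t] to be applied to the event {tau > t}. *)
Lemma history_survival (A : local_pattern d) (t : R) : 0 <= t ->
  history t (survival A t : set path).
Proof.
move=> t0; rewrite survival_bigcap//.
by apply: history_bigcap => m _; exact: history_dyadic_avoids.
Qed.

Lemma survival_shift (A : local_pattern d) (s t : R) : 0 <= s -> 0 <= t ->
  survival A (s + t) =
  survival A s `&` [set w : path | survival A t (shift_path s w)].
Proof.
move=> s0 t0; apply/seteqP; split => w.
  move=> /survivalP nA; split; apply/survivalP => x /andP[x0 xs].
    by apply: nA; rewrite x0 (le_trans xs)// lerDl.
  by apply: nA; rewrite max_r// addr_ge0//= lerD2l.
move=> [/survivalP nA1 /survivalP nA2]; apply/survivalP => x /andP[x0 xst].
have [xs|sx] := leP x s; first by apply: nA1; rewrite x0.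
have := nA2 (x - s); rewrite subr_ge0 (ltW sx) lerBlDl xst => /(_ isT) /=.
by rewrite max_r ?subr_ge0 ?(ltW sx)// addrC subrK.
Qed.

End paths.

(** * The Markov property *)

Section markov.
Local Open Scope ereal_scope.
Variables (R : realType) (d : nat).
Notation path := (cadlag_path R d).
Variable P : R.-pker (config d) ~> (cadlag_path R d).

Lemma measurable_integral_ker (F : path -> \bar R) : (forall w, 0 <= F w) ->
  measurable_fun setT F -> measurable_fun setT (fun eta => \int[P eta]_w F w).
Proof.
move=> F0 mF; apply: measurable_fun_integral_kernel => //.
by move=> U mU; exact: measurable_kernel.
Qed.

Lemma measurable_integral_ker_signed (F : path -> \bar R) :
  measurable_fun setT F -> measurable_fun setT (fun eta => \int[P eta]_w F w).
Proof.
move=> mF; under eq_fun do rewrite integralE.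
apply: emeasurable_funB; apply: measurable_integral_ker => //.
- exact: measurable_funepos.
- exact: measurable_funeneg.
Qed.

Lemma measurable_semigroup t (f : config d -> R) : measurable_fun setT f ->
  measurable_fun setT (semigroup P t f).
Proof.
move=> mf; apply: (measurableT_comp (@fine_measurable R setT measurableT)).
apply: measurable_integral_ker_signed; apply/measurable_EFinP.
exact: measurable_fun_path_at.
Qed.

Section initial.
Variable nu : probability (config d) R.

Lemma integral_path_law (F : path -> \bar R) : (forall w, 0 <= F w) ->
  measurable_fun setT F ->
  \int[path_law P nu]_w F w = \int[nu]_eta \int[P eta]_w F w.
Proof.
by apply: integral_mixture => // U mU; exact: measurable_kernel.
Qed.

(** The integral over nu of P_eta(N) is 0 for a null event N, and the integrand is nonnegative. *)
Lemma ae_path_law (E : set path) : {ae path_law P nu, forall w, E w} ->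
  {ae nu, forall eta, {ae P eta, forall w, E w}}.
Proof.
move=> [N [mN N0 EN]].
have : ae_eq nu setT (fun eta => P eta N) (cst 0).
  apply/ae_eq_integral_abs => //; first exact: measurable_kernel.
  by rewrite -[RHS]N0; apply: eq_integral => eta _; rewrite gee0_abs.
apply: filterS => eta /(_ I) PN; exists N; split => //.
Qed.

Hypothesis inv : invariant_law P nu.

Lemma integral_path_law_at t (f : config d -> \bar R) : (0 <= t)%R ->
  (forall eta, 0 <= f eta) -> measurable_fun setT f ->
  \int[path_law P nu]_w f (w t) = \int[nu]_eta f eta.
Proof.
move=> t0; apply: ge0_integral_image; first exact: measurable_path_at.
by move=> B mB; exact: inv.
Qed.

Lemma ae_path_law_at t (E : set (config d)) : (0 <= t)%R ->
  {ae nu, forall eta, E eta} -> {ae path_law P nu, forall w : path, E (w t)}.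
Proof.
move=> t0 [N [mN N0 EN]]; exists [set w : path | N (w t)]; split.
- by have := @measurable_path_at R d t measurableT _ mN; rewrite setTI.
- by rewrite /= -[LHS]/(path_law P nu _) /path_law inv.
- by move=> w Ew; exact: EN.
Qed.

Lemma Lfun2_path_at t (f : config d -> R) : (0 <= t)%R ->
  f \in Lfun nu 2%:E -> (fun w : path => f (w t)) \in Lfun (path_law P nu) 2%:E.
Proof.
move=> t0 /Lfun2P[mf fy]; apply/Lfun2P; split.
  exact: measurable_fun_path_at.
rewrite (integral_path_law_at t0 (f := fun x => (f x ^+ 2)%:E))//.
- by move=> eta; rewrite lee_fin sqr_ge0.
- by apply/measurable_EFinP; exact: measurable_funX.
Qed.

(** By invariance, evaluation at any time is an isometry from L^2(nu) into L^2 of the path law. *)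
Lemma norm2_path_at t (f : config d -> R) : (0 <= t)%R ->
  measurable_fun setT f ->
  norm2 (path_law P nu) (fun w => f (w t)) = norm2 nu f.
Proof.
move=> t0 mf; rewrite /norm2 !Lnorm2E.
rewrite (integral_path_law_at t0 (f := fun x => (f x ^+ 2)%:E))//.
- by move=> eta; rewrite lee_fin sqr_ge0.
- by apply/measurable_EFinP; exact: measurable_funX.
Qed.

(** Invariance turns the nu-integral of E_eta |f(eta_t)| into that of |f|, so the inner expectation
    is finite almost surely. Linearity of [semigroup] on L^2 is obtained on this set of full
    measure. *)
Lemma integrable_path_at t (f : config d -> \bar R) : (0 <= t)%R ->
  nu.-integrable setT f ->
  {ae nu, forall eta, (P eta).-integrable setT (fun w => f (w t))}.
Proof.
move=> t0 /integrableP[mf fy].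
have mabs : measurable_fun [set: path] (fun w => `|f (w t)|).
  apply: measurableT_comp => //.
  exact: measurableT_comp (@measurable_path_at R d t).
have int : nu.-integrable setT (fun eta => \int[P eta]_w `|f (w t)|).
  apply/integrableP; split; first exact: measurable_integral_ker.
  rewrite (eq_integral (fun eta => \int[P eta]_w `|f (w t)|)).
    rewrite -integral_path_law//.
    rewrite (integral_path_law_at t0 (f := fun x => `|f x|))//.
    exact: measurableT_comp.
  by move=> eta _; rewrite gee0_abs// integral_ge0.
have := integrable_ae measurableT int.
apply: filterS => eta /(_ I); rewrite ge0_fin_numE ?integral_ge0// => fin.
apply/integrableP; split => //.
exact: measurableT_comp (@measurable_path_at R d t).
Qed.

(** Jensen's inequality under each P_eta, followed by invariance. *)
Lemma Lfun2_semigroup t (f : config d -> R) : (0 <= t)%R ->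
  f \in Lfun nu 2%:E ->
  semigroup P t f \in Lfun nu 2%:E /\ (norm2 nu (semigroup P t f) <= norm2 nu f)%R.
Proof.
move=> t0 fL; have /Lfun2P[mf fy] := fL.
have le_int : \int[nu]_eta (semigroup P t f eta ^+ 2)%:E <=
    \int[nu]_eta (f eta ^+ 2)%:E.
  rewrite -(integral_path_law_at t0 (f := fun x => (f x ^+ 2)%:E)); last 2 first.
  - by move=> eta; rewrite lee_fin sqr_ge0.
  - by apply/measurable_EFinP; exact: measurable_funX.
  have mf2 : measurable_fun [set: path] (fun w => (f (w t) ^+ 2)%:E).
    by apply/measurable_EFinP/measurable_funX; exact: measurable_fun_path_at.
  have f20 (w : path) : 0 <= (f (w t) ^+ 2)%:E by rewrite lee_fin sqr_ge0.
  rewrite integral_path_law//; apply: ge0_le_integral => //.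
  - by move=> eta _; rewrite lee_fin sqr_ge0.
  - by apply/measurable_EFinP/measurable_funX; exact: measurable_semigroup.
  - exact: measurable_integral_ker.
  - move=> eta _; apply: le_sqr_Rintegral; first exact: prob_kernel.
    exact: measurable_fun_path_at.
suff SL : semigroup P t f \in Lfun nu 2%:E by split => //; exact: le_norm2.
apply/Lfun2P; split; first exact: measurable_semigroup.
exact: le_lt_trans le_int fy.
Qed.

Lemma Lfun2_integrable (f : config d -> R) : f \in Lfun nu 2%:E ->
  nu.-integrable setT (EFin \o f).
Proof.
move=> fL; apply/Lfun1_integrable; apply: Lfun_subset12 fL.
exact: fin_num_measure.
Qed.

Lemma semigroupB t (f g : config d -> R) : (0 <= t)%R ->
  f \in Lfun nu 2%:E -> g \in Lfun nu 2%:E ->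
  {ae nu, forall eta, semigroup P t (fun x => f x - g x)%R eta =
    (semigroup P t f eta - semigroup P t g eta)%R}.
Proof.
move=> t0 /Lfun2_integrable/(integrable_path_at t0) fi.
move=> /Lfun2_integrable/(integrable_path_at t0).
by move: fi; apply: filterS2 => eta fi gi; rewrite /semigroup RintegralB.
Qed.

Lemma semigroupZ t c (f : config d -> R) : (0 <= t)%R ->
  f \in Lfun nu 2%:E ->
  {ae nu, forall eta, semigroup P t (fun x => c * f x)%R eta =
    (c * semigroup P t f eta)%R}.
Proof.
move=> t0 /Lfun2_integrable/(integrable_path_at t0).
by apply: filterS => eta fi; rewrite /semigroup RintegralZl.
Qed.

End initial.

Hypothesis mP : markov_process P.

Lemma ae_start eta : {ae P eta, forall w : path, w 0%R = eta}.
Proof.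
have mE : measurable [set w : path | w 0%R = eta].
  have := @measurable_path_at R d 0 measurableT _ (measurable_config1 eta).
  by rewrite setTI.
exists (~` [set w : path | w 0%R = eta]); split => //; first exact: measurableC.
have PE := mP.1 eta; have PT := @prob_kernel _ _ _ _ _ P eta.
have Py : P eta setT < +oo by rewrite [X in X < _]PT ltry.
by rewrite -setTD measureD// setTI [X in X - _]PT [X in _ - X]PE subee.
Qed.

(** Almost every path under P_eta starts at eta, so the dependence on [w 0] can be frozen and then
    factored out of the integral. *)
Lemma integral_start (F : config d -> path -> \bar R) eta :
  measurable_fun setT (fun w : path => F (w 0%R) w) -> measurable_fun setT (F eta) ->
  \int[P eta]_w F (w 0%R) w = \int[P eta]_w F eta w.
Proof.
move=> mF mF'; apply: ae_eq_integral => //.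
by apply: filterS (ae_start eta) => w -> _.
Qed.

(** The Markov property with the sure event in the past says that the law of the shifted path is a
    mixture of the laws [P (w s)]. *)
Lemma integral_shift (F : path -> \bar R) s eta : (0 <= s)%R ->
  (forall w, 0 <= F w) -> measurable_fun setT F ->
  \int[P eta]_w F (shift_path s w) = \int[P eta]_w \int[P (w s)]_w' F w'.
Proof.
move=> s0 F0 mF.
pose phi := mfun_Sub (mem_set (@measurable_shift_path R d s s0)).
rewrite -(integral_mixture (m := pushforward (P eta) phi)
  (mu := P eta) (k := fun w => P (w s)))//.
- by apply: ge0_integral_image => //; exact: measurable_shift_path.
- move=> U mU.
  exact: measurableT_comp (measurable_kernel P U mU) (@measurable_path_at R d s).
- move=> U mU; rewrite /pushforward /=.
  by have := mP.2 eta s setT U s0 (@historyT _ _ _) mU; rewrite setTI.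
Qed.

(** The nonnegative case is applied to the positive and negative parts, both integrable; this serves
    the semigroup law on signed functions. *)
Lemma integral_shift_signed (F : path -> \bar R) s eta : (0 <= s)%R ->
  measurable_fun setT F ->
  (P eta).-integrable setT (fun w => F (shift_path s w)) ->
  (P eta).-integrable setT (fun w => \int[P (w s)]_w' F w') /\
  \int[P eta]_w F (shift_path s w) = \int[P eta]_w \int[P (w s)]_w' F w'.
Proof.
move=> s0 mF Fi.
have Fpi := integrable_funepos measurableT Fi.
have Fni := integrable_funeneg measurableT Fi.
rewrite (funepos_comp F) in Fpi; rewrite (funeneg_comp F) in Fni.
have mFp := measurable_funepos mF; have mFn := measurable_funeneg mF.
have mi (G : path -> \bar R) : (forall w, 0 <= G w) -> measurable_fun setT G ->
    (P eta).-integrable setT (fun w => G (shift_path s w)) ->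
    (P eta).-integrable setT (fun w => \int[P (w s)]_w' G w').
  move=> G0 mG /integrableP[_ Gy]; apply/integrableP; split.
    exact: measurableT_comp (measurable_integral_ker G0 mG)
      (@measurable_path_at R d s).
  rewrite (eq_integral (fun w : path => \int[P (w s)]_w' G w')); last first.
    by move=> w _; rewrite gee0_abs// integral_ge0.
  rewrite -integral_shift//.
  by under eq_integral do rewrite -[G _]gee0_abs//.
have Ip := mi F^\+ (fun=> funepos_ge0 _ _) mFp Fpi.
have In := mi F^\- (fun=> funeneg_ge0 _ _) mFn Fni.
have JE : (fun w : path => \int[P (w s)]_w' F w') =
    (fun w : path => \int[P (w s)]_w' F^\+ w' - \int[P (w s)]_w' F^\- w').
  by apply/funext => w; rewrite integralE.
rewrite JE; split; first exact: integrableB.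
by rewrite integralB// -!integral_shift// integralE funepos_comp funeneg_comp.
Qed.

Lemma semigroup_add (nu : probability (config d) R) s t (f : config d -> R) :
  invariant_law P nu -> (0 <= s)%R -> (0 <= t)%R -> f \in Lfun nu 2%:E ->
  {ae nu, forall eta,
    semigroup P (s + t) f eta = semigroup P s (semigroup P t f) eta}.
Proof.
move=> inv s0 t0 fL.
have := integrable_path_at inv (addr_ge0 s0 t0) (Lfun2_integrable fL).
apply: filterS => eta fi.
have shiftE : (fun w : path => (f (w (s + t)%R))%:E) =
    (fun w => (f (shift_path s w t))%:E).
  by apply/funext => w; rewrite /= max_r.
have mf : measurable_fun [set: path] (fun w => (f (w t))%:E).
  by apply/measurable_EFinP; exact: measurable_fun_path_at (Lfun_measurable fL).
rewrite shiftE in fi.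
have [Ji JE] := integral_shift_signed (F := fun w => (f (w t))%:E) s0 mf fi.
rewrite /semigroup [in LHS]/Rintegral shiftE JE; congr fine; apply: ae_eq_integral => //.
- exact: measurable_int Ji.
- apply/measurable_EFinP.
  exact: (measurable_fun_path_at s (measurable_semigroup t (Lfun_measurable fL))).
(* [semigroup] takes the [fine] part of the inner integral, which is finite almost surely by
   integrability. *)
- apply: filterS (integrable_ae measurableT Ji) => w /(_ I) Jfin _.
  by rewrite /semigroup /Rintegral fineK.
Qed.

End markov.

(** * Symmetry of the semigroup *)

Section symmetry.
Variables (R : realType) (d : nat).
Notation path := (cadlag_path R d).
Variable P : R.-pker (config d) ~> (cadlag_path R d).
Variable nu : probability (config d) R.
Hypothesis mP : markov_process P.
Hypothesis inv : invariant_law P nu.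
Notation S := (semigroup P).
Notation L2 := (Lfun nu 2%:E).
Notation G := (generator P nu).

Definition generator_error (h : R) (f f' : config d -> R) (eta : config d) : R :=
  (S h f eta - f eta) / h - f' eta.

Let mL2 (f : config d -> R) : f \in L2 -> measurable_fun setT f.
Proof. exact: Lfun_measurable. Qed.

Let SL2 t (f : config d -> R) : 0 <= t -> f \in L2 -> S t f \in L2.
Proof. by move=> t0 fL; have [] := Lfun2_semigroup inv t0 fL. Qed.

Let Snorm t (f : config d -> R) : 0 <= t -> f \in L2 ->
  norm2 nu (S t f) <= norm2 nu f.
Proof. by move=> t0 fL; have [] := Lfun2_semigroup inv t0 fL. Qed.

Lemma generator_errorE h f f' :
  generator_error h f f' = fun eta => h^-1 * (S h f eta - f eta) - f' eta.
Proof. by apply/funext => eta; rewrite /generator_error mulrC. Qed.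

Lemma Lfun2_generator_error h f f' : 0 <= h -> f \in L2 -> f' \in L2 ->
  generator_error h f f' \in L2.
Proof.
move=> h0 fL f'L; rewrite generator_errorE.
by apply: Lfun2B => //; apply/Lfun2Z/Lfun2B => //; exact: SL2.
Qed.

(** The semigroup law and linearity show that the error for [(S s f, S s f')] is almost surely [S s]
    applied to the error for [(f, f')], and [S s] is a contraction. The telescoping therefore has a
    uniform error bound. *)
Lemma norm2_generator_error s h f f' : 0 <= s -> 0 <= h ->
  f \in L2 -> f' \in L2 ->
  norm2 nu (generator_error h (S s f) (S s f')) <=
  norm2 nu (generator_error h f f').
Proof.
move=> s0 h0 fL f'L; have eL := Lfun2_generator_error h0 fL f'L.
apply: le_trans (Snorm s0 eL).
rewrite le_eqVlt; apply/orP; left; apply/eqP; apply: eq_norm2.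
- by apply: mL2; apply: Lfun2_generator_error => //; exact: SL2.
- by apply: mL2; exact: SL2.
have ShL := SL2 h0 fL; have dL := Lfun2B ShL fL.
rewrite !generator_errorE.
have e1 := semigroupB inv s0 (Lfun2Z h^-1 dL) f'L.
have e2 := semigroupZ inv h^-1 s0 dL.
have e3 := semigroupB inv s0 ShL fL.
have e4 := semigroup_add mP inv s0 h0 fL.
have e5 := semigroup_add mP inv h0 s0 fL.
apply: filterS3 e1 e2 (filterI e3 (filterI e4 e5)) => eta E1 E2 [E3 [E4 E5]].
by rewrite E1 E2 E3 -E4 -E5 (addrC h).
Qed.

Lemma generator_semigroup s f f' : 0 <= s -> G f f' -> G (S s f) (S s f').
Proof.
move=> s0 [fL f'L ff']; split; [exact: SL2|exact: SL2|].
apply: (squeeze_cvge _ (cvg_cst 0%E) ff'); near=> h.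
have h0 : 0 <= h by apply/ltW; near: h; exact: nbhs_right_gt.
rewrite Lnorm_ge0/=.
have e1 := Lfun2_generator_error h0 (SL2 s0 fL) (SL2 s0 f'L).
have e2 := Lfun2_generator_error h0 fL f'L.
rewrite -[leLHS](norm2E e1) -[leRHS](norm2E e2) lee_fin.
exact: norm2_generator_error.
Unshelve. all: by end_near. Qed.

Hypothesis sa : self_adjoint nu G.

Let error_bound h f f' g g' : R :=
  norm2 nu f * norm2 nu (generator_error h g g') +
  norm2 nu (generator_error h f f') * norm2 nu g.

Let semigroup_error h f f' : h != 0 ->
  S h f = fun eta => f eta + h * (f' eta + generator_error h f f' eta).
Proof.
move=> h0; apply/funext => eta; rewrite /generator_error; field.
exact: h0.
Qed.

(** In the expansion of [S h] to first order, the terms of order 0 coincide and those of order [h]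
    cancel by symmetry of the generator; only the errors remain, paired by Cauchy-Schwarz. *)
Let dot_step h f f' g g' : 0 < h -> G f f' -> G g g' ->
  `|dot nu f (S h g) - dot nu (S h f) g| <= h * error_bound h f f' g g'.
Proof.
move=> h0 Gf Gg; have [fL f'L _] := Gf; have [gL g'L _] := Gg.
have [_ _ /(_ _ _ Gg) sym] := (sa.2 f f').1 Gf.
have efL := Lfun2_generator_error (ltW h0) fL f'L.
have egL := Lfun2_generator_error (ltW h0) gL g'L.
have fE := @semigroup_error h f f' (lt0r_neq0 h0).
have gE := @semigroup_error h g g' (lt0r_neq0 h0).
rewrite /error_bound.
move: (generator_error h f f') (generator_error h g g') efL egL fE gE.
move=> ef eg efL egL fE gE.
have -> : dot nu f (S h g) - dot nu (S h f) g =
    h * (dot nu f eg - dot nu ef g).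
  rewrite (dotC nu f) fE gE.
  have hf := Lfun2D f'L efL; have hg := Lfun2D g'L egL.
  rewrite !dotDl//; try exact: Lfun2Z.
  rewrite !dotZl// !dotDl// (dotC nu f' g) -[dot nu g f']sym -/(dot nu g' f).
  by rewrite (dotC nu g f) (dotC nu f eg); ring.
rewrite normrM (gtr0_norm h0) ler_wpM2l ?(ltW h0)//.
apply: (le_trans (ler_normB _ _)); rewrite lerD//; exact: ler_norm_dot.
Qed.

Let error_bound_semigroup s h f f' g g' : 0 <= s -> 0 <= h ->
  G f f' -> G g g' ->
  error_bound h f f' (S s g) (S s g') <= error_bound h f f' g g' /\
  error_bound h (S s f) (S s f') g g' <= error_bound h f f' g g'.
Proof.
move=> s0 h0 [fL f'L _] [gL g'L _].
by split; rewrite lerD// ?ler_wpM2l ?ler_wpM2r ?norm2_ge0//;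
  (exact: norm2_generator_error || exact: Snorm).
Qed.

Lemma semigroup0 f : measurable_fun setT f -> S 0 f = f.
Proof.
move=> mf; apply/funext => eta.
rewrite /semigroup /Rintegral.
rewrite (integral_start mP (F := fun x _ => (f x)%:E))//.
  by rewrite integral_cst// [X in (_ * X)%E](@prob_kernel _ _ _ _ _ P eta) mule1.
by apply/measurable_EFinP; exact: measurable_fun_path_at.
Qed.

(** Induction on the number of steps: one step is moved from [g] to [f], the remaining [n] by the
    induction hypothesis for [S h f]. The error bound does not grow when the semigroup is applied to
    either argument. *)
Let dot_steps n h f f' g g' : 0 < h -> G f f' -> G g g' ->
  `|dot nu f (S (n%:R * h) g) - dot nu (S (n%:R * h) f) g| <=
  (n%:R * h) * error_bound h f f' g g'.
Proof.
move=> h0; elim: n f f' => [|n IH] f f' Gf Gg.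
  have [fL _ _] := Gf; have [gL _ _] := Gg.
  by rewrite !mul0r !semigroup0 ?subrr ?normr0//; exact: mL2.
have [fL f'L _] := Gf; have [gL g'L _] := Gg.
have nh0 : 0 <= n%:R * h by rewrite mulr_ge0// ltW.
have eg := semigroup_add mP inv (ltW h0) nh0 gL.
have ef := semigroup_add mP inv nh0 (ltW h0) fL.
have nE : n.+1%:R * h = h + n%:R * h by rewrite -natr1 mulrDl mul1r addrC.
have nE0 : 0 <= h + n%:R * h by rewrite addr_ge0// ltW.
have -> : dot nu f (S (n.+1%:R * h) g) = dot nu f (S h (S (n%:R * h) g)).
  rewrite nE; apply: eq_dotr eg; apply: mL2; [exact: fL|exact: SL2|].
  by apply: SL2; [exact: ltW|exact: SL2].
have -> : dot nu (S (n.+1%:R * h) f) g = dot nu (S (n%:R * h) (S h f)) g.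
  rewrite nE addrC; apply: eq_dotl ef; apply: mL2; last exact: gL.
    by apply: SL2; [rewrite addrC|].
  by apply: SL2; [|apply: SL2; [exact: ltW|]].
have Gg' := generator_semigroup nh0 Gg.
have Gf' := generator_semigroup (ltW h0) Gf.
have s1 := dot_step h0 Gf Gg'.
have s2 := IH _ _ Gf' Gg.
have [b1 _] := error_bound_semigroup nh0 (ltW h0) Gf Gg.
have [_ b2] := error_bound_semigroup (ltW h0) (ltW h0) Gf Gg.
(* The intermediate term has one step on the left and [n] on the right. *)
rewrite -(subrKA (dot nu (S h f) (S (n%:R * h) g))).
apply: (le_trans (ler_normD _ _)); rewrite nE mulrDl lerD//.
  by apply: (le_trans s1); rewrite ler_wpM2l// ltW.
by apply: (le_trans s2); rewrite ler_wpM2l.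
Qed.

Let le0_eps (x C : R) : 0 <= C -> (forall e, 0 < e -> x <= C * e) -> x <= 0.
Proof.
move=> C0 H; apply/ler_addgt0Pr => e e0; rewrite add0r.
have C1 : 0 < C + 1 by rewrite ltr_wpDl.
(* Dividing by [C + 1] covers the case [C = 0]. *)
apply: (le_trans (H (e / (C + 1)) _)); first by rewrite divr_gt0.
by rewrite mulrA ler_pdivrMr// mulrC ler_wpM2l ?(ltW e0)// lerDl.
Qed.

Let dot_generator t f f' g g' : 0 <= t -> G f f' -> G g g' ->
  dot nu f (S t g) = dot nu (S t f) g.
Proof.
rewrite le_eqVlt => /predU1P[<- [fL _ _] [gL _ _]|t0 Gf Gg].
  by rewrite !semigroup0//; exact: mL2.
have [fL f'L cf] := Gf; have [gL g'L cg] := Gg.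
apply/eqP; rewrite -subr_eq0 -normr_le0.
apply: (@le0_eps _ (t * (norm2 nu f + norm2 nu g))).
  by rewrite mulr_ge0 ?(ltW t0)// addr_ge0 ?norm2_ge0.
move=> e e0.
have small k k' : 'N[nu]_2%:E[EFin \o generator_error h k k']%E @[h --> 0^'+] --> 0%E ->
    \forall h \near 0^'+, norm2 nu (generator_error h k k') < e.
  move=> /fine_cvg /cvgrPdist_lt/(_ _ e0); apply: filterS => h.
  by rewrite sub0r normrN => /(le_lt_trans (ler_norm _)).
have : \forall h \near 0^'+, norm2 nu (generator_error h f f') < e /\
    norm2 nu (generator_error h g g') < e.
  by near=> h; split; near: h; exact: small.
move=> /nbhs_right0P[del /= del0 Hdel].
(* Since n > t / del, the step t / n is below the scale [del] under which both generator errors are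
   smaller than [e]. *)
pose n := (Num.truncn (t / del)).+1; pose h := t / n%:R.
have h0 : 0 < h by rewrite divr_gt0// ltr0n.
have hdel : h < del.
  rewrite /h ltr_pdivrMr ?ltr0n// mulrC -ltr_pdivrMr//.
  by have /andP[] := truncn_itv (divr_ge0 (ltW t0) (ltW del0)).
have [] := Hdel h _ h0; first by rewrite /= sub0r normrN gtr0_norm.
rewrite add0r => ef eg.
have := @dot_steps n h _ _ _ _ h0 Gf Gg.
rewrite (_ : n%:R * h = t); last by rewrite /h mulrCA divff ?mulr1// pnatr_eq0.
move=> /le_trans; apply; rewrite -mulrA ler_wpM2l ?(ltW t0)//.
rewrite mulrDl lerD ?ler_wpM2l ?norm2_ge0//; first exact: ltW.
by rewrite mulrC ler_wpM2l ?norm2_ge0// ltW.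
Unshelve. all: by end_near. Qed.

(** The domain is dense: replacing [f] by a [p] of the domain at distance less than [e] changes each
    side by at most [e] times the norm of [g], as [S t] is a contraction. *)
Let dot_closure t f g : 0 <= t -> f \in L2 -> g \in L2 ->
  (forall p q, G p q -> dot nu p (S t g) = dot nu (S t p) g) ->
  dot nu f (S t g) = dot nu (S t f) g.
Proof.
move=> t0 fL gL H; apply/eqP; rewrite -subr_eq0 -normr_le0.
apply: (@le0_eps _ (norm2 nu g + norm2 nu g)) => [|e e0].
  by rewrite addr_ge0 ?norm2_ge0.
have [p [q [Gpq fp]]] := sa.1 f fL e e0; have [pL _ _] := Gpq.
have dL := Lfun2B fL pL.
have {}fp : norm2 nu (fun x => f x - p x) < e by rewrite -lte_fin norm2E.
have SgL := SL2 t0 gL.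
have -> : dot nu f (S t g) - dot nu (S t f) g =
    dot nu (fun x => f x - p x) (S t g) - dot nu (S t (fun x => f x - p x)) g.
  have -> : dot nu (S t (fun x => f x - p x)) g =
      dot nu (fun x => S t f x - S t p x) g.
    apply: eq_dotl; [| |exact: mL2|exact: semigroupB].
    - by apply: mL2; exact: SL2.
    - by apply: mL2; apply: Lfun2B; exact: SL2.
  rewrite (dotBl fL pL SgL) (dotBl (SL2 t0 fL) (SL2 t0 pL) gL) (H _ _ Gpq).
  by rewrite opprB addrA subrK.
apply: (le_trans (ler_normB _ _)); rewrite mulrDl lerD//.
  apply: (le_trans (ler_norm_dot dL SgL)); rewrite mulrC.
  by rewrite ler_pM ?norm2_ge0 ?Snorm// ltW.
apply: (le_trans (ler_norm_dot (SL2 t0 dL) gL)); rewrite mulrC.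
by rewrite ler_wpM2l ?norm2_ge0// (le_trans (Snorm t0 dL))// ltW.
Qed.

Lemma semigroup_symmetric t f g : 0 <= t -> f \in L2 -> g \in L2 ->
  dot nu f (S t g) = dot nu (S t f) g.
Proof.
move=> t0 fL gL; apply: dot_closure => // p p' Gp; have [pL _ _] := Gp.
(* The first argument is now in the domain; exchanging the two sides allows the same density
   argument for the second one. *)
rewrite dotC [RHS]dotC; symmetry; apply: dot_closure => // q q' Gq.
exact: dot_generator Gq Gp.
Qed.

End symmetry.

(** * Time reversal of the killed process *)

Section survival_reversible.
Variables (R : realType) (d : nat).
Notation path := (cadlag_path R d).
Variable P : R.-pker (config d) ~> (cadlag_path R d).
Variable nu : probability (config d) R.
Hypothesis mP : markov_process P.
Hypothesis inv : invariant_law P nu.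
Variable A : local_pattern d.
Notation S := (semigroup P).
Notation L2 := (Lfun nu 2%:E).
Notation B := (~` pattern_set A).

Let mB : measurable B.
Proof. by apply: measurableC; exact: measurable_pattern. Qed.

(** A step tests A only at its starting time. The function to which the iterates are applied thus
    carries a factor [\1_B] of its own, which tests the last grid time. *)
Definition killed_step (h : R) (f : config d -> R) (eta : config d) : R :=
  \1_B eta * S h f eta.

Definition avoids_at (n : nat) (h : R) (C : set (config d)) : set path :=
  avoids A n h `&` [set w | C (w (n%:R * h))].

Lemma avoids_atS n h C : 0 <= h -> avoids_at n.+1 h C =
  [set w : path | B (w 0)] `&` [set w | avoids_at n h C (shift_path h w)].
Proof.
move=> h0; have sE (w : path) k : shift_path h w (k%:R * h) = w (k.+1%:R * h).
  by rewrite /= max_r ?mulr_ge0// -[in RHS]natr1 mulrDl mul1r addrC.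
apply/seteqP; split => w.
  move=> [av Cw]; split; first by have := av 0 isT; rewrite mul0r.
  split; last by move: Cw; rewrite /= -sE.
  by move=> k kn; rewrite sE; exact: av.
move=> [B0 [av Cw]]; split; last by rewrite /= -sE.
case=> [_|k kn]; first by rewrite mul0r.
by rewrite -sE; exact: av.
Qed.

Lemma measurable_avoids_at n h C : 0 <= h -> measurable C ->
  measurable (avoids_at n h C).
Proof.
move=> h0 mC; apply: measurableI.
  by apply: (@history_measurable_set R d (n%:R * h)); exact: history_avoids.
by have := @measurable_path_at R d (n%:R * h) measurableT _ mC; rewrite setTI.
Qed.

Lemma ker_le1 eta (E : set path) : measurable E -> (P eta E <= 1)%E.
Proof.
move=> mE; rewrite -(@prob_kernel _ _ _ _ _ P eta).
by apply: le_measure => //; rewrite inE.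
Qed.

Lemma fin_num_ker eta (E : set path) : measurable E -> P eta E \is a fin_num.
Proof.
by move=> mE; rewrite ge0_fin_numE// (le_lt_trans (ker_le1 _ mE))// ltry.
Qed.

Lemma ker_start eta (E : set path) (C : set (config d)) :
  measurable E -> measurable C ->
  P eta (E `&` [set w | C (w 0)]) = ((\1_C eta)%:E * P eta E)%E.
Proof.
move=> mE mC.
have mC0 : measurable [set w : path | C (w 0)].
  by have := @measurable_path_at R d 0 measurableT _ mC; rewrite setTI.
have mI := measurableI _ _ mE mC0.
have m1E : measurable_fun setT (fun w : path => (\1_E w : R)%:E).
  by apply/measurable_EFinP; exact: measurable_indic.
rewrite -[in LHS](setIT (E `&` _)) -integral_indic//.
rewrite (eq_integral (fun w : path => (\1_C (w 0))%:E * (\1_E w)%:E)%E); last first.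
  by move=> w _; rewrite indicI/= mulrC EFinM !indicE; congr (_%:R%:E * _)%E;
    apply/idP/idP; rewrite !inE.
rewrite (integral_start mP (F := fun x w => (\1_C x)%:E * (\1_E w)%:E)%E).
- by rewrite ge0_integralZl_EFin// integral_indic// setIT.
- apply: emeasurable_funM => //; apply/measurable_EFinP.
  exact: measurable_fun_path_at (measurable_indic mC).
- exact: measurable_funeM.
Qed.

(** Induction on [n] with the Markov property at time [h]: the first grid time gives the indicator,
    the shifted path the remaining steps. *)
Lemma ker_avoids_at n h C eta : 0 <= h -> measurable C ->
  P eta (avoids_at n h C) = (iter n (killed_step h) (\1_(B `&` C)) eta)%:E.
Proof.
move=> h0 mC; elim: n eta => [|n IH] eta.
  have -> : avoids_at 0 h C = setT `&` [set w : path | (B `&` C) (w 0)].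
    rewrite setTI; apply/seteqP; split => w.
      by move=> [/(_ 0 isT)]; rewrite mul0r; split => //; rewrite -(mul0r h).
    move=> [Bw Cw]; split; last by rewrite /= mul0r.
    by case=> // _; rewrite mul0r.
  rewrite [LHS](ker_start eta measurableT (measurableI _ _ mB mC)).
  by rewrite [X in (_ * X)%E](@prob_kernel _ _ _ _ _ P eta) mule1.
pose F := iter n (killed_step h) (\1_(B `&` C)).
have mn := measurable_avoids_at n h0 mC.
have PF xi : P xi (avoids_at n h C) = (F xi)%:E by exact: IH.
have F0 xi : 0 <= F xi by rewrite -lee_fin -PF.
(* Being a probability, [F] is bounded, so its integral after one step is finite and agrees with the
   real-valued [semigroup]. *)
have F1 xi : F xi <= 1 by rewrite -lee_fin -PF ker_le1.
have mF : measurable_fun setT (EFin \o F).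
  by rewrite (_ : _ \o _ = P ^~ (avoids_at n h C)); [exact: measurable_kernel|
    apply/funext => xi; rewrite PF].
have mB0 : measurable [set w : path | B (w 0)].
  by have := @measurable_path_at R d 0 measurableT _ mB; rewrite setTI.
have mFh : measurable_fun setT (fun w : path => (F (w h))%:E).
  exact: measurableT_comp mF (@measurable_path_at R d h).
rewrite avoids_atS// mP.2//; last by apply: history_at => //; rewrite lexx.
rewrite integral_mkcond.
rewrite (eq_integral (fun w : path => (\1_B (w 0))%:E * (F (w h))%:E)%E); last first.
  move=> w _; rewrite /patch PF indicE.
  rewrite (_ : (w \in [set w : path | B (w 0)]) = (w 0 \in B)); last first.
    by apply/idP/idP; rewrite !inE.
  by case: ifP => _; rewrite ?mul1e ?mul0e.
rewrite (integral_start mP (F := fun x w => (\1_B x)%:E * (F (w h))%:E)%E).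
- rewrite ge0_integralZl_EFin//; last by move=> w _; rewrite lee_fin.
  rewrite iterS /killed_step EFinM; congr (_ * _)%E.
  rewrite /semigroup /Rintegral fineK//.
  rewrite ge0_fin_numE; last by apply: integral_ge0 => w _; rewrite lee_fin F0.
  apply: (@le_lt_trans _ _ (\int[P eta]_w cst 1%E w)%E).
    by apply: ge0_le_integral => // w _; rewrite lee_fin ?F0 ?F1.
  by rewrite integral_cst// [X in (_ * X)%E](@prob_kernel _ _ _ _ _ P eta) mule1 ltry.
- apply: emeasurable_funM => //; apply/measurable_EFinP.
  exact: measurable_fun_path_at (measurable_indic mB).
- exact: measurable_funeM.
Qed.

Lemma path_law_start (E : set path) (C : set (config d)) :
  measurable E -> measurable C ->
  path_law P nu (E `&` [set w | C (w 0)]) = (\int[nu]_(eta in C) P eta E)%E.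
Proof.
move=> mE mC; rewrite [RHS]integral_mkcond; apply: eq_integral => eta _.
rewrite ker_start// indicE /patch.
by case: ifP => _; rewrite ?mul1e ?mul0e.
Qed.

Hypothesis sa : self_adjoint nu (generator P nu).

Let Lfun2_indicM (C : set (config d)) f : measurable C -> f \in L2 ->
  (fun x => \1_C x * f x) \in L2.
Proof.
move=> mC fL; have [] // := @Lfun2_bounded_mul _ _ _ nu \1_C f 1 ler01 _ _ fL.
by move=> x; rewrite indicE normr_nat lern1 leq_b1.
Qed.

Let Lfun2_killed_step n h f : 0 <= h -> f \in L2 ->
  iter n (killed_step h) f \in L2.
Proof.
move=> h0 fL; elim: n => //= n IH; apply: Lfun2_indicM => //.
by have [] := Lfun2_semigroup inv h0 IH.
Qed.

(** Multiplication by [\1_B] and [S h] are both symmetric, and so is the palindromic product of [n]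
    factors [S h] separated and surrounded by [\1_B]. *)
Lemma killed_step_symmetric n h f g : 0 <= h -> f \in L2 -> g \in L2 ->
  dot nu (iter n (killed_step h) (fun x => \1_B x * f x)) g =
  dot nu f (iter n (killed_step h) (fun x => \1_B x * g x)).
Proof.
move=> h0 fL; elim: n g => [|n IH] g gL.
  by apply: eq_Rintegral => x _ /=; ring.
have SL k : k \in L2 -> S h k \in L2.
  by move=> kL; have [] := Lfun2_semigroup inv h0 kL.
have KL : iter n (killed_step h) (fun x => \1_B x * f x) \in L2.
  by apply: Lfun2_killed_step => //; exact: Lfun2_indicM.
have gL' : (fun x => \1_B x * g x) \in L2 by exact: Lfun2_indicM.
rewrite [in RHS]iterSr -[RHS](IH _ (SL _ gL')) (semigroup_symmetric mP inv sa h0)//.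
by apply: eq_Rintegral => x _; rewrite /= /killed_step; ring.
Qed.

(** The two sides are [dot nu (K C) \1_setT] and [dot nu (K setT) \1_C], which symmetry of the
    killed chain exchanges. *)
Let path_law_avoids_at n h C : 0 <= h -> measurable C ->
  path_law P nu (avoids_at n h C) =
  path_law P nu (avoids A n h `&` [set w | C (w 0)]).
Proof.
move=> h0 mC.
have mn := measurable_avoids_at n h0.
have avT : avoids A n h = avoids_at n h setT.
  by rewrite /avoids_at (_ : [set w | _] = setT) ?setIT//; exact/seteqP.
have oneL (D : set (config d)) : measurable D -> (\1_D : _ -> R) \in L2.
  move=> mD; rewrite (_ : \1_D = fun x => \1_D x * cst 1 x); last first.
    by apply/funext => x; rewrite mulr1.
  apply: Lfun2_indicM => //; exact: Lfun_cst.
pose K D := iter n (killed_step h) (\1_(B `&` D)).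
have KP D eta : measurable D -> P eta (avoids_at n h D) = (K D eta)%:E.
  by move=> mD; exact: ker_avoids_at.
have KL D : measurable D -> K D \in L2.
  by move=> mD; apply: Lfun2_killed_step => //; apply: oneL; exact: measurableI.
have KE D : K D = iter n (killed_step h) (fun x => \1_B x * \1_D x).
  by rewrite /K indicI.
have dotE D C' : measurable D -> measurable C' ->
    (\int[nu]_(eta in C') P eta (avoids_at n h D))%E = (dot nu (K D) \1_C')%:E.
  move=> mD mC'; rewrite /dot /Rintegral fineK; last first.
    apply: integrable_fin_num => //; apply: Lfun2_mul_integrable; first exact: KL.
    exact: oneL.
  rewrite [LHS]integral_mkcond; apply: eq_integral => eta _.
  rewrite /patch KP// indicE; case: ifP => _; by rewrite ?mulr1 ?mulr0.
rewrite path_law_start//; last by rewrite avT; exact: mn.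
transitivity (\int[nu]_(eta in setT) P eta (avoids_at n h C))%E => //.
rewrite avT !dotE// !KE; congr EFin.
by rewrite killed_step_symmetric//; try exact: oneL; rewrite dotC.
Qed.

(** The identity holds on each dyadic grid; it passes to the intersection of the decreasing grid
    events by continuity from above. *)
Lemma survival_reversible t C : 0 <= t -> measurable C ->
  path_law P nu (survival A t `&` [set w | C (w t)]) =
  path_law P nu (survival A t `&` [set w | C (w 0)]).
Proof.
move=> t0 mC.
have mCs s : measurable [set w : path | C (w s)].
  by have := @measurable_path_at R d s measurableT _ mC; rewrite setTI.
have md m : measurable (dyadic_avoids A t m : set path).
  exact: history_measurable_set (history_dyadic_avoids A m t0).
have lim s : path_law P nu (dyadic_avoids A t m `&` [set w | C (w s)]) @[m --> \oo]
    --> path_law P nu (survival A t `&` [set w | C (w s)]).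
  have mI m : measurable (dyadic_avoids A t m `&` [set w : path | C (w s)]).
    by apply: measurableI; [exact: md|exact: mCs].
  rewrite survival_bigcap// -bigcapIl; last by exists 0%N.
  apply: nonincreasing_cvg_mu => //.
  - by rewrite (le_lt_trans (@probability_le1 _ _ _ (path_law P nu) _ _)) ?ltry//.
  - by apply: (@bigcap_measurableType _ path) => m _; exact: mI.
  - move=> m n mn; apply/subsetPset; apply: setSI.
    exact: nonincreasing_dyadic_avoids.
have := lim t; rewrite (_ : (fun m => _) =
  fun m => path_law P nu (dyadic_avoids A t m `&` [set w | C (w 0)])).
  by move=> /cvg_lim <-//; move: (lim 0) => /cvg_lim <-.
apply/funext => m.
have tE : (2 ^ m)%:R * (t / (2 ^ m)%:R) = t.
  by rewrite mulrC divfK// natr_exp2_neq0.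
rewrite -path_law_avoids_at//; first by rewrite /avoids_at tE.
by rewrite divr_ge0.
Qed.

End survival_reversible.

(** * The law conditioned on survival *)

Lemma integralZ_dot d (T : measurableType d) (R : realType)
    (mu : {measure set T -> \bar R}) (c : R) (f g : T -> R) :
  f \in Lfun mu 2%:E -> g \in Lfun mu 2%:E ->
  (\int[mu]_x (c * (f x * g x))%:E = (c * dot mu f g)%:E)%E.
Proof.
move=> fL gL; have fgi := Lfun2_mul_integrable fL gL.
under eq_integral do rewrite EFinM.
rewrite integralZl// EFinM; congr (_ * _)%E.
by rewrite /dot /Rintegral fineK//; exact: integrable_fin_num.
Qed.

(** * Stability of the weighted pairing *)

Section pairing.
Variables (R : realType) (d : nat).
Notation path := (cadlag_path R d).
Variable P : R.-pker (config d) ~> (cadlag_path R d).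
Variable nu : probability (config d) R.
Hypothesis inv : invariant_law P nu.
Notation Q := (path_law P nu).
Notation L2 := (Lfun nu 2%:E).

(* The limit, and its approximation at time t, are ratios of expectations
   E_nu[b(w) f(w_0) g(w_r)] for two densities f and g. *)
Definition pairing (r : R) (b : path -> R) (f g : config d -> R) : R :=
  dot Q (fun w => b w * f (w 0)) (fun w => g (w r)).

Variables (r M : R) (b : path -> R).
Hypothesis r0 : 0 <= r.
Hypothesis M0 : 0 <= M.
Hypothesis mb : measurable_fun setT b.
Hypothesis bM : forall w, `|b w| <= M.

Lemma Lfun2_pairing_left f : f \in L2 ->
  (fun w : path => b w * f (w 0)) \in Lfun Q 2%:E.
Proof.
move=> fL; have f0L := Lfun2_path_at inv (lexx 0) fL.
by have [] := Lfun2_bounded_mul M0 mb bM f0L.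
Qed.

(** The pairing is bilinear and bounded by [M] times the product of the norms. The norm of [g] is
    replaced by a bound in terms of [g'] and [g - g'], so that only the limit and the errors
    appear. *)
Lemma pairing_dist f g f' g' :
  f \in L2 -> g \in L2 -> f' \in L2 -> g' \in L2 ->
  `|pairing r b f g - pairing r b f' g'| <=
  M * (norm2 nu (fun x => f x - f' x) *
         (norm2 nu g' + norm2 nu (fun x => g x - g' x)) +
       norm2 nu f' * norm2 nu (fun x => g x - g' x)).
Proof.
move=> fL gL f'L g'L.
have dfL := Lfun2B fL f'L; have dgL := Lfun2B gL g'L.
have rL h : h \in L2 -> (fun w : path => h (w r)) \in Lfun Q 2%:E.
  exact: Lfun2_path_at.
(* Cauchy-Schwarz on path space, then invariance at times 0 and [r]. *)
have bound h k : h \in L2 -> k \in L2 ->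
    `|pairing r b h k| <= M * (norm2 nu h * norm2 nu k).
  move=> hL kL; apply: (le_trans (ler_norm_dot (Lfun2_pairing_left hL) (rL _ kL))).
  rewrite (norm2_path_at inv r0 (Lfun_measurable kL)) mulrA ler_wpM2r ?norm2_ge0//.
  have h0L := Lfun2_path_at inv (lexx 0) hL.
  have [_] := Lfun2_bounded_mul M0 mb bM h0L.
  by rewrite (norm2_path_at inv (lexx 0) (Lfun_measurable hL)).
have -> : pairing r b f g - pairing r b f' g' =
    pairing r b (fun x => f x - f' x) g + pairing r b f' (fun x => g x - g' x).
  rewrite /pairing dotBr ?rL ?Lfun2_pairing_left//.
  rewrite [X in _ = X + _](_ : _ = dot Q (fun w : path =>
    b w * f (w 0) - b w * f' (w 0)) (fun w => g (w r))); last first.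
    by apply: eq_Rintegral => w _; rewrite mulrBr.
  by rewrite dotBl ?rL ?Lfun2_pairing_left//; ring.
apply: (le_trans (ler_normD _ _)); rewrite mulrDr lerD ?bound//.
apply: (le_trans (bound _ _ dfL gL)); rewrite ler_wpM2l// ler_wpM2l ?norm2_ge0//.
rewrite [leLHS](_ : _ = norm2 nu (fun x => g' x + (g x - g' x))).
  exact: ler_norm2D.
by congr (norm2 nu _); apply/funext => x; rewrite addrC subrK.
Qed.

End pairing.

(** * Survival probabilities and the shifted law on survival *)

Section conditioned.
Variables (R : realType) (d : nat).
Notation path := (cadlag_path R d).
Variable P : R.-pker (config d) ~> (cadlag_path R d).
Variable nu : probability (config d) R.
Hypothesis mP : markov_process P.
Hypothesis inv : invariant_law P nu.
Variable A : local_pattern d.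
Notation Q := (path_law P nu).
Notation L2 := (Lfun nu 2%:E).
Notation surv t := (survival A t : set path).

Definition survival_mass (t : R) : R := fine (Q (surv t)).
Notation Z := survival_mass.

Definition survival_prob (t : R) (eta : config d) : R :=
  fine (P eta (surv t)).
Notation p := survival_prob.

Let mS t : measurable (surv t). Proof. exact: measurable_survival. Qed.

Let m_at t (C : set (config d)) : measurable C ->
  measurable [set w : path | C (w t)].
Proof.
by move=> mC; have := @measurable_path_at R d t measurableT _ mC; rewrite setTI.
Qed.

Lemma survival_massE t : (Z t)%:E = Q (surv t).
Proof.
rewrite fineK// ge0_fin_numE//.
by rewrite (le_lt_trans (probability_le1 (path_law P nu) (mS t)))// ltry.
Qed.

Lemma survival_probE t eta : (p t eta)%:E = P eta (surv t).
Proof. by rewrite fineK// fin_num_ker. Qed.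

Lemma survival_prob_ge0 t eta : 0 <= p t eta.
Proof. exact: fine_ge0. Qed.

Lemma survival_prob_le1 t eta : p t eta <= 1.
Proof. by rewrite -lee_fin survival_probE ker_le1. Qed.

Lemma measurable_survival_prob t : measurable_fun setT (p t).
Proof.
apply/measurable_EFinP; rewrite (_ : _ \o _ = P ^~ (surv t)).
  exact: measurable_kernel.
by apply/funext => eta; exact: survival_probE.
Qed.

(** The survival mass is nonincreasing; if it vanished at [t], it would vanish from then on, and
    with the convention that [ln] is 0 at 0 the decay rate would be 0. *)
Lemma survival_mass_gt0 lambda t : 0 < lambda -> is_decay_rate P nu A lambda ->
  0 < Z t.
Proof.
move=> l0 dec; rewrite lt0r fine_ge0// andbT; apply/eqP => Zt.
suff : lambda = 0 by move=> le; rewrite le ltxx in l0.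
apply: (cvg_unique (@norm_hausdorff _ _) dec).
apply: (@cvg_trans _ (cst (0 : R) @ +oo)); last exact: cvg_cst.
apply: near_eq_cvg; near=> s => /=.
have Zs : Z s <= 0.
  rewrite -Zt -lee_fin !survival_massE le_measure ?inE//.
  move=> w /survivalP nA; apply/survivalP => x /andP[x0 xt]; apply: nA.
  by rewrite x0 (le_trans xt)//; near: s; exact: nbhs_pinfty_ge.
by rewrite ln0// mulr0 oppr0.
Unshelve. all: by end_near. Qed.

(** Positivity of the mass selects the genuine normalization in [mnormalize]. *)
Lemma cond_path_lawE t (G : set path) : 0 < Z t -> measurable G ->
  cond_path_law P nu A t G = ((Z t)^-1%:E * Q (surv t `&` G))%E.
Proof.
move=> Z0 mG; rewrite /cond_path_law /= /mnormalize /=.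
rewrite (_ : mrestr _ _ setT = (Z t)%:E); last first.
  by rewrite survival_massE /mrestr setTI.
rewrite eqe gt_eqF//= muleC; congr (_ * _)%E.
by rewrite setIC.
Qed.

Hypothesis sa : self_adjoint nu (generator P nu).

(** On every event C, the integral of [p t] is Q(tau > t, eta_0 in C), which time reversal turns
    into Q(tau > t, eta_t in C), that is, [Z t] times the integral of [g]. *)
Lemma survival_density t (g : {mfun config d >-> R}) : 0 <= t -> 0 < Z t ->
  is_density nu (cond_law P nu A t) g -> (g : config d -> R) \in L2 ->
  {ae nu, forall eta, p t eta = Z t * g eta}.
Proof.
move=> t0 Z0 dg gL.
have gi := Lfun2_integrable gL.
have pi : nu.-integrable setT (EFin \o p t).
  apply: (le_integrable measurableT _ _ 
    (finite_measure_integrable_cst nu 1 measurableT)).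
  - by apply/measurable_EFinP; exact: measurable_survival_prob.
  - move=> eta _ /=; rewrite lee_fin normr1 ger0_norm ?survival_prob_ge0//.
    exact: survival_prob_le1.
have : ae_eq nu setT (EFin \o p t) (fun eta => (Z t)%:E * (g eta)%:E)%E.
  apply: integral_ae_eq => // [|C _ mC].
    by apply: measurable_funeM; apply/measurable_EFinP.
  rewrite integralZl//; last exact: integrableS gi.
  transitivity (\int[nu]_(eta in C) P eta (surv t))%E.
    by apply: eq_integral => eta _; rewrite -survival_probE.
  rewrite -path_law_start// -survival_reversible// -dg//.
  rewrite /cond_law /distribution /pushforward /=.
  rewrite [X in (_ * X)%E](cond_path_lawE Z0 (m_at t mC)).
  by rewrite muleA -EFinM divff ?mul1e// gt_eqF.
by apply: filterS => eta /(_ I) /= [].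
Qed.

(** The Markov property at time [a] isolates a function [k] of eta_a on {tau > a}; reversal on
    [0, a] replaces eta_a by eta_0, so that the past contributes [p a (w 0)]; the Markov property at
    time [r] then expands [k] and gives [p s (w r)]. *)
Lemma path_law_survival_shift a r s (G : set path) :
  0 <= a -> 0 <= r -> 0 <= s -> history r G ->
  Q (surv (a + (r + s)) `&` [set w | G (shift_path a w)]) =
  (\int[Q]_(w in G) (p a (w 0) * (\1_(surv r) w * p s (w r)))%:E)%E.
Proof.
move=> a0 r0 s0 hG; have mG := history_measurable_set hG.
pose k xi := P xi (surv (r + s) `&` G).
have k0 xi : (0 <= k xi)%E by [].
have mk : measurable_fun setT k by apply: measurable_kernel; exact: measurableI.
have mk_at t : measurable_fun setT (fun w : path => k (w t)).
  exact: measurableT_comp mk (@measurable_path_at R d t).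
have m1 E : measurable E -> measurable_fun setT (fun w : path => (\1_E w : R)%:E).
  by move=> mE; apply/measurable_EFinP; exact: measurable_indic.
have m1_ge0 E (w : path) : (0 <= (\1_E w : R)%:E)%E by rewrite lee_fin.
have mpE t s' : measurable_fun setT (fun w : path => (p t (w s'))%:E).
  apply/measurable_EFinP; apply: measurable_fun_path_at.
  exact: measurable_survival_prob.
have pE0 t (w : path) s' : (0 <= (p t (w s'))%:E)%E.
  by rewrite lee_fin survival_prob_ge0.
(* Markov property at time [a]. *)
have step12 : Q (surv (a + (r + s)) `&` [set w | G (shift_path a w)]) =
    (\int[Q]_w (k (w a) * (\1_(surv a) w)%:E))%E.
  rewrite integral_path_law//; last 2 first.
  - by move=> w; rewrite mule_ge0.
  - by apply: emeasurable_funM => //; exact: m1.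
  apply: eq_integral => eta _.
  rewrite survival_shift ?addr_ge0// -setIA.
  have hS := history_survival A a0.
  rewrite (mP.2 eta a (surv a) (surv (r + s) `&` G) a0 hS); last exact: measurableI.
  rewrite integral_mkcond; apply: eq_integral => w _; rewrite /patch indicE.
  by case: ifP => _; rewrite ?mule1 ?mule0.
pose mu := mrestr Q (mS a).
have image t (E : set (config d)) : measurable E -> mu [set w | E (w t)] =
    (\int[Q]_(w in [set w | E (w t)]) (\1_(surv a) w)%:E)%E.
  by move=> mE; rewrite integral_indic//; [rewrite /mu /mrestr setIC|exact: m_at].
(* Time reversal: restricted to {tau > a}, the path law has the same image under evaluation at [a]
   and at 0. *)
have step3 : (\int[Q]_w (k (w a) * (\1_(surv a) w)%:E) =
    \int[Q]_w (k (w 0%R) * (\1_(surv a) w)%:E))%E.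
  rewrite -(ge0_integral_image_density (m := mrestr Q (mS a)) (m' := Q)
    (psi := fun w : path => w a) (phi := fun w : path => w a) (rho := \1_(surv a)))//.
  - apply: ge0_integral_image_density => //; try exact: measurable_path_at.
    move=> E mE; rewrite integral_indic//; last exact: m_at.
    transitivity (Q (surv a `&` [set w | E (w a)])); first by rewrite setIC.
    exact: survival_reversible.
  - exact: measurable_path_at.
  - exact: measurable_path_at.
  - by move=> E mE; exact: image.
rewrite step12 step3 integral_path_law//; last 2 first.
- by move=> w; rewrite mule_ge0.
- by apply: emeasurable_funM => //; exact: m1.
rewrite [RHS]integral_mkcond.
have restrE : ((fun w : path => (p a (w 0%R) * (\1_(surv r) w * p s (w r)))%:E) \_ G) =
    (fun w => (p a (w 0%R))%:E * ((\1_(surv r `&` G) w)%:E * (p s (w r))%:E))%E.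
  apply/funext => w; rewrite /patch indicI/= [\1_G w]indicE.
  by case: ifP => _; rewrite ?mulr1 ?mulr0 ?mul0e ?mule0// -!EFinM.
rewrite restrE integral_path_law//; last 2 first.
- by move=> w; rewrite !mule_ge0.
- apply: emeasurable_funM => //; apply: emeasurable_funM => //; apply: m1.
  exact: measurableI.
have mSG : measurable (surv r `&` G) by exact: measurableI.
apply: eq_integral => eta _.
(* With the starting point frozen at eta, the left side becomes [k eta] times P_eta(tau > a), and
   [p a eta] factors out of the right side. *)
rewrite (integral_start mP (F := fun x w => k x * (\1_(surv a) w)%:E)%E); last 2 first.
- by apply: emeasurable_funM => //; exact: m1.
- by apply: emeasurable_funM => //; exact: m1.
rewrite (integral_start mP (F := fun x w =>
  (p a x)%:E * ((\1_(surv r `&` G) w)%:E * (p s (w r))%:E))%E); last 2 first.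
- by apply: emeasurable_funM => //; apply: emeasurable_funM => //; exact: m1.
- by apply: emeasurable_funM => //; apply: emeasurable_funM => //; exact: m1.
rewrite ge0_integralZl_EFin ?survival_prob_ge0//; last 2 first.
- by move=> w _; rewrite mule_ge0.
- by apply: emeasurable_funM => //; exact: m1.
rewrite survival_probE muleC -/(k eta) ge0_integralZl//; last exact: m1.
rewrite integral_indic// setIT; congr (_ * _)%E.
(* Markov property at time [r], with the event {tau > r} and [G] in the past. *)
rewrite /k survival_shift// setIAC.
have hSG := historyI (history_survival A r0) hG.
rewrite (mP.2 eta r _ (surv s) r0 hSG) // integral_mkcond.
apply: eq_integral => w _; rewrite /patch indicE -survival_probE.
by case: ifP => _; rewrite ?mul1e ?mul0e.
Qed.

End conditioned.

Lemma history_measurable_fun (R : realType) d r (phi : cadlag_path R d -> R) :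
  history_measurable r phi -> measurable_fun setT phi.
Proof.
by move=> hphi _ B mB; rewrite setTI; exact: history_measurable_set (hphi B mB).
Qed.

(** Only events before time [r] are compared, which suffices because the preimages under [phi] are
    such events: the transfer formula is applied to the values of [phi]. *)
Lemma integral_history_density (R : realType) d d' (X : measurableType d')
    (m : {measure set X -> \bar R}) (Q : {measure set (cadlag_path R d) -> \bar R})
    (psi : X -> cadlag_path R d) r (phi rho : cadlag_path R d -> R) :
  measurable_fun setT psi -> measurable_fun setT rho ->
  (forall w, 0 <= rho w) -> (forall w, 0 <= phi w) -> history_measurable r phi ->
  (forall G, history r G -> m (psi @^-1` G) = (\int[Q]_(w in G) (rho w)%:E)%E) ->
  (\int[m]_x (phi (psi x))%:E = \int[Q]_w (phi w * rho w)%:E)%E.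
Proof.
move=> mpsi mrho rho0 phi0 hphi mG; have mphi := history_measurable_fun hphi.
(* The absolute value makes the integrand a function of [phi] that is nonnegative on the whole real
   line. *)
rewrite (eq_integral (fun x => (`|phi (psi x)|)%:E)); last first.
  by move=> x _; rewrite ger0_norm.
rewrite (ge0_integral_image_density (m := m) (m' := Q) (f := fun x => (`|x|)%:E)
  (psi := phi \o psi) (phi := phi) (rho := rho))//.
- by apply: eq_integral => w _; rewrite ger0_norm.
- exact: measurableT_comp.
- by move=> B mB; rewrite -mG//; exact: hphi.
- by apply/measurable_EFinP; exact: normr_measurable.
Qed.

(** * Conditioned expectations as pairings *)

Section conditioned_integral.
Variables (R : realType) (d : nat).
Notation path := (cadlag_path R d).
Variable P : R.-pker (config d) ~> (cadlag_path R d).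
Variable nu : probability (config d) R.
Hypothesis mP : markov_process P.
Hypothesis inv : invariant_law P nu.
Hypothesis sa : self_adjoint nu (generator P nu).
Variable A : local_pattern d.
Notation Q := (path_law P nu).
Notation L2 := (Lfun nu 2%:E).
Notation surv t := (survival A t : set path).
Notation Z := (survival_mass P nu A).
Notation p := (survival_prob P A).

Variables (r M : R) (phi : path -> R).
Hypothesis r0 : 0 <= r.
Hypothesis hphi : history_measurable r phi.
Hypothesis phi0 : forall w, 0 <= phi w.
Hypothesis phiM : forall w, phi w <= M.

Definition survival_weight (w : path) : R := \1_(surv r) w * phi w.

Let mS t : measurable (surv t). Proof. exact: measurable_survival. Qed.

Lemma measurable_survival_weight : measurable_fun setT survival_weight.
Proof.
apply: measurable_funM; first exact: measurable_indic.
exact: history_measurable_fun hphi.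
Qed.

Lemma survival_weight_bound w : `|survival_weight w| <= M.
Proof.
rewrite /survival_weight normrM [X in _ * X]ger0_norm// indicE normr_nat.
by case: (_ \in _); rewrite ?mul1r// mul0r (le_trans (phi0 w)).
Qed.

Let M0 : 0 <= M.
Proof. exact: le_trans (phi0 (cst_path R point)) (phiM _). Qed.

(** Before time [r], the shifted conditioned law has density [rho] with respect to Q; each survival
    probability in it is then replaced by its mass times the conditioned density. *)
Lemma integral_cond_path_law t a s (ga gs : {mfun config d >-> R}) :
  0 <= a -> 0 <= s -> t = a + (r + s) -> 0 < Z t -> 0 < Z a -> 0 < Z s ->
  is_density nu (cond_law P nu A a) ga -> (ga : config d -> R) \in L2 ->
  is_density nu (cond_law P nu A s) gs -> (gs : config d -> R) \in L2 ->
  (\int[cond_path_law P nu A t]_w (phi (shift_path a w))%:E =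
   ((Z t)^-1 * Z a * Z s * pairing P nu r survival_weight ga gs)%:E)%E.
Proof.
move=> a0 s0 tE Zt Za Zs da gaL ds gsL.
pose rho (w : path) := (Z t)^-1 * (p a (w 0) * (\1_(surv r) w * p s (w r))).
have mp u s' : measurable_fun setT (fun w : path => p u (w s')).
  by apply: measurable_fun_path_at; exact: measurable_survival_prob.
have mrho' : measurable_fun setT
    (fun w : path => p a (w 0) * (\1_(surv r) w * p s (w r))).
  apply: measurable_funM; first exact: mp.
  by apply: measurable_funM; [exact: measurable_indic|exact: mp].
have mrho : measurable_fun setT rho by apply: measurable_funM.
have rho'0 (w : path) : 0 <= p a (w 0) * (\1_(surv r) w * p s (w r)).
  by rewrite !mulr_ge0// survival_prob_ge0.
have rho0 w : 0 <= rho w by rewrite mulr_ge0// invr_ge0 ltW.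
rewrite (integral_history_density (Q := Q) (r := r) (rho := rho))//; last 2 first.
- exact: measurable_shift_path.
- move=> G hG; have mG := history_measurable_set hG.
  have mGa : measurable [set w : path | G (shift_path a w)].
    by have := measurable_shift_path a0 measurableT mG; rewrite setTI.
  rewrite [LHS](cond_path_lawE Zt mGa) {2}tE (path_law_survival_shift mP inv A sa)//.
  rewrite -ge0_integralZl_EFin ?invr_ge0 ?(ltW Zt)//.
  - by move=> w _; rewrite lee_fin.
  - by apply/measurable_EFinP; exact: measurable_funTS.
have wL := Lfun2_pairing_left inv M0 measurable_survival_weight
  survival_weight_bound gaL.
rewrite /pairing -integralZ_dot//; last exact: Lfun2_path_at.
have mphi := history_measurable_fun hphi.
apply: ae_eq_integral => //.
- by apply/measurable_EFinP; exact: measurable_funM.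
- apply/measurable_EFinP; apply: measurable_funM => //; apply: measurable_funM.
    exact: Lfun_measurable wL.
  exact: measurable_fun_path_at (Lfun_measurable gsL).
(* Invariance carries the nu-almost sure identities to the configurations at times 0 and [r]. *)
have ea := ae_path_law_at inv (lexx 0) (survival_density mP inv sa a0 Za da gaL).
have es := ae_path_law_at inv r0 (survival_density mP inv sa s0 Zs ds gsL).
move: ea es; apply: filterS2 => w ea es _.
by rewrite /rho ea es /survival_weight; congr EFin; ring.
Qed.

(** * The limiting law up to time r *)

Variable u : {mfun config d >-> R}.
Hypothesis uL : (u : config d -> R) \in L2.
Hypothesis u_neq0 : ~ {ae nu, forall eta, u eta = 0}.
Hypothesis u_ge0 : {ae nu, forall eta, 0 <= u eta}.

Definition square_mass : R := fine (\int[nu]_x (u x ^+ 2)%:E)%E.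

Let measurable_sqr_u D : measurable_fun D (fun x => (u x ^+ 2)%:E).
Proof. by apply/measurable_EFinP/measurable_funX; exact: measurable_funTS. Qed.

Lemma square_massE : (square_mass%:E = \int[nu]_x (u x ^+ 2)%:E)%E.
Proof.
rewrite fineK// ge0_fin_numE; last first.
  by apply: integral_ge0 => x _; rewrite lee_fin sqr_ge0.
by have /Lfun2P[] := uL.
Qed.

Lemma square_mass_gt0 : 0 < square_mass.
Proof.
rewrite lt0r fine_ge0 ?andbT; last first.
  by apply: integral_ge0 => x _; rewrite lee_fin sqr_ge0.
apply/eqP => c0; apply: u_neq0.
have : ae_eq nu setT (fun x => (u x ^+ 2)%:E) (cst 0%E).
  apply/ae_eq_integral_abs => //.
  rewrite -[RHS]/(0%:E) -c0 square_massE; apply: eq_integral => x _.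
  by rewrite gee0_abs// lee_fin sqr_ge0.
by apply: filterS => x /(_ I) [] /eqP; rewrite sqrf_eq0 => /eqP.
Qed.

Lemma normalized_squareE B : measurable B ->
  normalized_square nu u B = (\int[nu]_(x in B) (u x ^+ 2 / square_mass)%:E)%E.
Proof.
move=> mB; rewrite /normalized_square /= /mnormalize /=.
rewrite [square_measure _ _ setT](_ : _ = square_mass%:E); last first.
  by rewrite square_massE.
have c0 := square_mass_gt0.
rewrite eqe gt_eqF//= muleC /square_measure -ge0_integralZl_EFin//.
- by apply: eq_integral => x _; rewrite mulrC EFinM.
- by move=> x _; rewrite lee_fin sqr_ge0.
- by rewrite invr_ge0 ltW.
Qed.

Variables (lambda : R) (Pu : R.-pker (config d) ~> (cadlag_path R d)).
Hypothesis doob : is_doob_transform P nu A lambda u Pu.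

Definition doob_constant : R := expR (lambda * r) / square_mass.

(** The absolute values make the density nonnegative everywhere, while [u] is so only almost
    surely. *)
Let doob_density (w : path) : R :=
  doob_constant * (`|u (w 0)| * (\1_(surv r) w * `|u (w r)|)).

Let mabsu t : measurable_fun setT (fun w : path => `|u (w t)|).
Proof.
exact: (measurable_fun_path_at t (measurableT_comp (@normr_measurable R setT) (@measurable_funPT _ _ _ _ u))).
Qed.

Let m1 : measurable_fun setT (fun w : path => \1_(surv r) w : R).
Proof. exact: measurable_indic. Qed.

Let mdoob_density : measurable_fun setT doob_density.
Proof.
apply: measurable_funM => //; apply: measurable_funM => //.
exact: measurable_funM.
Qed.

Let doob_density_ge0 w : 0 <= doob_density w.
Proof.
by rewrite !mulr_ge0// ?expR_ge0// invr_ge0 ltW// square_mass_gt0.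
Qed.

(** The transform is known up to a null set of the normalized square of [u]; such a set is nu-null
    away from the zeros of [u]. *)
Let ae_doob : {ae nu, forall xi, u xi != 0 -> forall G, history r G ->
  (Pu xi G = (u xi)^-1%:E * \int[P xi]_w (\1_G w * u (w r) * expR (lambda * r)
     * \1_(surv r) w)%:E)%E}.
Proof.
have [N [mN N0 DN]] := doob r0.
have : ae_eq nu N (fun x => (u x ^+ 2 / square_mass)%:E) (cst 0%E).
  apply/ae_eq_integral_abs => //.
    apply/measurable_EFinP; apply: measurable_funM => //.
    by apply: measurable_funX; exact: measurable_funTS.
  rewrite -[RHS]N0 -[RHS]/(normalized_square nu u N) normalized_squareE//.
  apply: eq_integral => x _; rewrite gee0_abs// lee_fin divr_ge0 ?sqr_ge0//.
  exact/ltW/square_mass_gt0.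
apply: filterS => xi Nxi uxi; apply: contrapT => nD.
have /Nxi[/eqP] : N xi by apply: DN => /= D; exact: nD.
by rewrite mulf_eq0 sqrf_eq0 (negbTE uxi)/= invr_eq0 gt_eqF// square_mass_gt0.
Qed.

(** The factor u^2 of the initial law times the factor 1/u of the transform leaves [u (w 0)]. *)
Let path_law_doob G : history r G ->
  path_law Pu (normalized_square nu u) G =
  (\int[Q]_(w in G) (doob_density w)%:E)%E.
Proof.
move=> hG; have mG := history_measurable_set hG.
have c0 := square_mass_gt0.
have mFe (x : config d) : measurable_fun setT (fun w : path =>
    (\1_G w * `|u (w r)| * expR (lambda * r) * \1_(surv r) w)%:E).
  apply/measurable_EFinP; apply: measurable_funM => //.
  by apply: measurable_funM => //; apply: measurable_funM.
have restrE : ((EFin \o doob_density) \_ G) = fun w =>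
    ((`|u (w 0)| / square_mass)%:E * (\1_G w * `|u (w r)| * expR (lambda * r)
      * \1_(surv r) w)%:E)%E.
  apply/funext => w; rewrite /patch [\1_G w]indicE /doob_density /doob_constant.
  case: ifP => _; rewrite -EFinM /=; first by congr EFin; ring.
  by rewrite !mul0r mulr0.
rewrite integral_mkcond restrE integral_path_law; last 2 first.
- by move=> w; rewrite mule_ge0// lee_fin ?divr_ge0 ?(ltW c0)// !mulr_ge0 ?expR_ge0.
- apply: emeasurable_funM => //; last exact: mFe point.
  by apply/measurable_EFinP; exact: measurable_funM.
transitivity (\int[nu]_xi (Pu xi G * (u xi ^+ 2 / square_mass)%:E))%E.
  apply: (ge0_integral_image_density (psi := id) (phi := id)
    (rho := fun xi => u xi ^+ 2 / square_mass) (f := Pu ^~ G)) => //.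
  - by move=> xi; rewrite divr_ge0 ?sqr_ge0// ltW.
  - by apply: measurable_funM => //; exact: measurable_funX.
  - exact: normalized_squareE.
  - exact: measurable_kernel.
(* For almost every starting point, [u (w r)] is nonnegative almost surely, which removes its
   absolute value. *)
have upos := ae_path_law (ae_path_law_at inv r0 u_ge0).
apply: ae_eq_integral => //.
- apply: emeasurable_funM; first exact: measurable_kernel.
  by apply/measurable_EFinP; apply: measurable_funM => //; exact: measurable_funX.
- apply: measurable_integral_ker.
    by move=> w; rewrite mule_ge0// lee_fin ?divr_ge0 ?(ltW c0)// !mulr_ge0 ?expR_ge0.
  apply: emeasurable_funM => //; last exact: mFe point.
  by apply/measurable_EFinP; exact: measurable_funM.
move: ae_doob u_ge0 upos; apply: filterS3 => xi Dxi uxi uw _.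
rewrite (integral_start mP (F := fun x w => ((`|u x| / square_mass)%:E *
  (\1_G w * `|u (w r)| * expR (lambda * r) * \1_(surv r) w)%:E)%E)); last 2 first.
- apply: emeasurable_funM => //; last exact: mFe point.
  by apply/measurable_EFinP; exact: measurable_funM.
- by apply: measurable_funeM; exact: mFe point.
rewrite ge0_integralZl_EFin ?divr_ge0 ?(ltW c0)//; last exact: mFe point.
(* Both sides vanish where [u] does. *)
rewrite ger0_norm//; have [->|u0] := eqVneq (u xi) 0.
  by rewrite expr0n/= !mul0r mule0 mul0e.
rewrite (Dxi u0 _ hG) muleC muleA -EFinM; congr (_ * _)%E.
  by congr EFin; field; rewrite u0 gt_eqF.
apply: ae_eq_integral => //.
- apply/measurable_EFinP; apply: measurable_funM => //.
  apply: measurable_funM => //; apply: measurable_funM => //.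
  exact: measurable_fun_path_at.
- exact: mFe point.
- by apply: filterS uw => w uw _; rewrite ger0_norm.
Qed.

Lemma integral_doob :
  (\int[normalized_square nu u]_eta \int[Pu eta]_w (phi w)%:E =
   (doob_constant * pairing P nu r survival_weight u u)%:E)%E.
Proof.
have mphi := history_measurable_fun hphi.
rewrite -integral_path_law//; last exact/measurable_EFinP.
rewrite (integral_history_density (psi := id) (Q := Q) (r := r)
  (rho := doob_density))//.
have wL := Lfun2_pairing_left inv M0 measurable_survival_weight
  survival_weight_bound uL.
rewrite /pairing -integralZ_dot//; last exact: Lfun2_path_at.
apply: ae_eq_integral => //.
- by apply/measurable_EFinP; exact: measurable_funM.
- apply/measurable_EFinP; apply: measurable_funM => //; apply: measurable_funM.
    exact: Lfun_measurable wL.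
  exact: measurable_fun_path_at.
have e0 := ae_path_law_at inv (lexx 0) u_ge0.
have er := ae_path_law_at inv r0 u_ge0.
move: e0 er; apply: filterS2 => w e0 er _.
by rewrite /doob_density !ger0_norm// /survival_weight; congr EFin; ring.
Qed.

End conditioned_integral.

(** * Conclusion *)

(** On the set C where [f] is negative, the integral of |f| is -mu(C), hence at most 0, so that [f]
    vanishes almost everywhere on C. *)
Lemma is_density_ge0 d (T : measurableType d) (R : realType)
    (nu : {measure set T -> \bar R}) (mu : {measure set T -> \bar R})
    (f : T -> R) : measurable_fun setT f ->
  is_density nu mu f -> {ae nu, forall x, 0 <= f x}.
Proof.
move=> mf muf; pose C := [set x | f x < 0].
have mC : measurable C.
  rewrite (_ : C = f @^-1` `]-oo, 0[).
    by rewrite -[X in measurable X]setTI; apply: mf => //; exact: measurable_itv.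
  by apply/seteqP; split=> x /=; rewrite in_itv.
have : ae_eq nu C (EFin \o f) (cst 0%E).
  apply/ae_eq_integral_abs => //.
    by apply/measurable_EFinP; exact: measurable_funTS.
  apply/eqP; rewrite eq_le integral_ge0 ?andbT//.
  rewrite -oppe_ge0 -integral_ge0N//.
  rewrite (eq_integral (EFin \o f)); first by rewrite -muf.
  by move=> x; rewrite inE => fx; rewrite /= ltr0_norm// opprK.
apply: filterS => x H; rewrite leNgt; apply/negP => fx.
by have := H fx => -[] f0; rewrite f0 ltxx in fx.
Qed.

(** Used to pass from a bounded functional to its nonnegative translate and back. *)
Lemma integral_subr_cst d (T : measurableType d) (R : realType)
    (m : {measure set T -> \bar R}) (f : T -> R) (M C : R) :
  m [set: T] = 1%E -> measurable_fun setT f -> (forall x, `|f x| <= C) ->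
  (\int[m]_x (f x)%:E \is a fin_num /\
   \int[m]_x (f x - M)%:E = \int[m]_x (f x)%:E - M%:E)%E.
Proof.
move=> mT mf fC.
have cstE c : (\int[m]_x (cst c%:E x) = c%:E)%E by rewrite integral_cst// mT mule1.
have ci c : m.-integrable setT (cst c%:E).
  apply/integrableP; split; first exact: measurable_cst.
  by rewrite (eq_integral (cst `|c|%:E))// cstE ltry.
have fi : m.-integrable setT (EFin \o f).
  apply: (le_integrable measurableT _ _ (ci C)); first exact/measurable_EFinP.
  by move=> x _ /=; rewrite lee_fin (le_trans (fC x))// ler_norm.
split; first exact: integrable_fin_num.
under eq_integral do rewrite EFinB.
by rewrite (integralB measurableT fi (ci M)); congr (_ - _)%E; exact: cstE.
Qed.

Theorem proposition1p9 (R : realType) (d : nat)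
    (P : R.-pker (config d) ~> (cadlag_path R d))
    (nu : probability (config d) R)
    (A : local_pattern d)
    (mu : probability (config d) R) (lambda : R)
    (u : {mfun config d >-> R})
    (g : R -> {mfun config d >-> R})
    (Pu : R.-pker (config d) ~> (cadlag_path R d))
    (a : R -> R) (r : R) (phi : cadlag_path R d -> R) :
  markov_process P ->
  invariant_law P nu ->
  self_adjoint nu (generator P nu) ->
  is_yaglom_limit P nu A mu ->
  0 < lambda ->
  is_decay_rate P nu A lambda ->
  is_density nu mu u ->
  (u : config d -> R) \in Lfun nu 2%:E ->
  is_simple_eigenfunction P nu A lambda u ->
  {ae nu, forall eta, ~ pattern_set A eta -> 0 < u eta} ->
  (forall t, 0 <= t -> is_density nu (cond_law P nu A t) (g t)) ->
  'N[nu]_2%:E [(fun eta => (g t eta - u eta)%:E)]%E @[t --> +oo] --> 0%E ->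
  is_doob_transform P nu A lambda u Pu ->
  {in `]0, +oo[ &, {homo a : s t / s <= t}} ->
  (forall t, 0 < t -> 0 < a t) ->
  a t @[t --> +oo] --> +oo ->
  (t - a t) @[t --> +oo] --> +oo ->
  0 < r ->
  history_measurable r phi ->
  (exists M, forall w, `|phi w| <= M) ->
  (\int[cond_path_law P nu A t]_w (phi (shift_path (a t) w))%:E)%E
    @[t --> +oo] -->
  (\int[normalized_square nu u]_eta \int[Pu eta]_w (phi w)%:E)%E.
Proof.
move=> mP inv sa _ l0 dec du uL [_ u_neq0 _ _] _ dg gu doob _ _ a_oo ta_oo r_gt0.
move=> hphi [M phiM].
have r0 := ltW r_gt0.
have u_ge0 := is_density_ge0 (@measurable_funPT _ _ _ _ u) du.
have Z0 t := survival_mass_gt0 t l0 dec.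
pose e s := norm2 nu (fun x => g s x - u x).
have e0 : e s @[s --> +oo] --> 0 by exact: fine_cvg gu.
(* The norm of [g s - u] is eventually finite, and [u] is square-integrable. *)
have gL : \forall s \near +oo, (g s : config d -> R) \in Lfun nu 2%:E.
  have := cvg_is_fine gu; apply: filterS => s Ns.
  have dL : (fun x => g s x - u x) \in Lfun nu 2%:E.
    rewrite inE; apply/andP; split; rewrite inE/=; first exact: measurable_funB.
    by rewrite /finite_norm -ge0_fin_numE// Lnorm_ge0.
  rewrite (_ : (g s : config d -> R) = fun x => u x + (g s x - u x)).
    exact: Lfun2D.
  by apply/funext => x; rewrite addrC subrK.
(* Time left after the window [a_t, a_t + r]; it tends to infinity because [r] is fixed. *)
pose s t := t - a t - r.
have s_oo : s t @[t --> +oo] --> +oo.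
  apply/cvgryPge => B; move/cvgryPge: ta_oo => /(_ (B + r)).
  by apply: filterS => t Ht; rewrite /s lerBrDr.
have ea := cvg_comp _ _ a_oo e0; have es := cvg_comp _ _ s_oo e0.
pose W (psi : cadlag_path R d -> R) := survival_weight A r psi.
pose J psi t := pairing P nu r (W psi) (g (a t)) (g (s t)).
pose Jlim psi := pairing P nu r (W psi) u u.
(* The formulas for expectations require nonnegative functionals: [phi] is translated by its bound,
   and [one] serves to determine the normalizing constants. *)
pose psi w := phi w + M.
pose one (w : cadlag_path R d) : R := 1.
have hpsi : history_measurable r psi.
  move=> B mB; apply: (hphi ((fun x => x + M) @^-1` B)).
  rewrite -[X in measurable X]setTI.
  by have := @measurable_funD _ _ R setT id (cst M); apply.
have hone : history_measurable r one.
  move=> B mB; rewrite [X in history _ X](preimage_cst (1 : R) B).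
  by case: ifP => _; [exact: historyT|exact: sigma_algebra0].
have psi0 w : 0 <= psi w.
  by rewrite -lerBlDr sub0r; have := phiM w; rewrite ler_norml => /andP[].
have psiM w : psi w <= M + M.
  by rewrite lerD2r; exact: le_trans (ler_norm _) (phiM w).
have one0 w : 0 <= one w by rewrite ler01.
have one1 w : one w <= 1 by [].
have J_cvg k C : (forall w, 0 <= k w) -> (forall w, k w <= C) ->
    history_measurable r k -> J k t @[t --> +oo] --> Jlim k.
  move=> k0 kC hk; have C0 := le_trans (k0 (cst_path R point)) (kC _).
  have Wm : measurable_fun setT (W k) by exact: measurable_survival_weight.
  have WC w : `|W k w| <= C by exact: survival_weight_bound.
  (* The bound of [pairing_dist] with [u] as limit on both sides. *)
  pose B t := C * (e (a t) * (norm2 nu u + e (s t)) + norm2 nu u * e (s t)).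
  have B0 : B t @[t --> +oo] --> 0.
    rewrite (_ : 0 = C * (0 * (norm2 nu u + 0) + norm2 nu u * 0)); last by ring.
    apply: cvgM; first exact: cvg_cst.
    apply: cvgD; apply: cvgM => //; last exact: cvg_cst.
    by apply: cvgD => //; exact: cvg_cst.
  apply/cvgrPdist_le => eps eps0.
  move/cvgrPdist_le : B0 => /(_ eps eps0) B0.
  near=> t.
  have gaL : (g (a t) : config d -> R) \in Lfun nu 2%:E.
    by near: t; exact: a_oo gL.
  have gsL : (g (s t) : config d -> R) \in Lfun nu 2%:E.
    by near: t; exact: s_oo gL.
  rewrite distrC (le_trans (pairing_dist inv r0 C0 Wm WC gaL gsL uL uL))//.
  have : `|0 - B t| <= eps by near: t; exact: B0.
  by rewrite sub0r normrN; apply: le_trans; exact: ler_norm.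
pose c t := (survival_mass P nu A t)^-1 * survival_mass P nu A (a t) *
  survival_mass P nu A (s t).
have condE : \forall t \near +oo, 0 <= a t /\
    (forall k C, (forall w, 0 <= k w) -> (forall w, k w <= C) ->
    history_measurable r k ->
    (\int[cond_path_law P nu A t]_w (k (shift_path (a t) w))%:E =
    (c t * J k t)%:E)%E).
  near=> t.
  have a0 : 0 <= a t by near: t; exact: a_oo (nbhs_pinfty_ge (num_real 0)).
  have s0 : 0 <= s t by near: t; exact: s_oo (nbhs_pinfty_ge (num_real 0)).
  split => // k C k0 kC hk.
  apply: (integral_cond_path_law mP inv sa r0 hk k0 kC) => //.
  - by rewrite /s; ring.
  - exact: dg.
  - by near: t; exact: a_oo gL.
  - exact: dg.
  - by near: t; exact: s_oo gL.
pose K := doob_constant nu r u lambda.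
have doobE k C : (forall w, 0 <= k w) -> (forall w, k w <= C) ->
    history_measurable r k ->
    (\int[normalized_square nu u]_eta \int[Pu eta]_w (k w)%:E =
     (K * Jlim k)%:E)%E.
  by move=> k0 kC hk; exact: (integral_doob mP inv r0 hk k0 kC uL u_neq0 u_ge0 doob).
(* The limiting law has mass 1, which determines [K] without evaluating lambda or the mass of
   u^2. *)
have K1 : K * Jlim one = 1.
  apply: EFin_inj; rewrite -(doobE _ _ one0 one1 hone).
  rewrite (eq_integral (cst 1%E)).
    by rewrite integral_cst// mul1e; exact: probability_setT.
  move=> eta _; rewrite (eq_integral (cst 1%E))// integral_cst// mul1e.
  exact: prob_kernel.
have Jlim1 : Jlim one != 0.
  by apply: contra_eq_neq K1 => ->; rewrite mulr0 eq_sym oner_eq0.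
have psi_bound w : `|psi w| <= M + M by rewrite ger0_norm.
have mpsi := history_measurable_fun hpsi.
(* The limit is rewritten as a ratio of pairings, the translation by [M] being undone. *)
have -> : (\int[normalized_square nu u]_eta \int[Pu eta]_w (phi w)%:E)%E =
    (Jlim psi / Jlim one - M)%:E.
  have inner eta : (\int[Pu eta]_w (phi w)%:E = \int[Pu eta]_w (psi w)%:E - M%:E)%E.
    have [_ <-] := integral_subr_cst M (@prob_kernel _ _ _ _ _ Pu eta) mpsi psi_bound.
    by apply: eq_integral => w _; rewrite addrK.
  under eq_integral do rewrite inner.
  have Gi : (normalized_square nu u).-integrable setT
      (fun eta => \int[Pu eta]_w (psi w)%:E)%E.
    apply/integrableP; split.
      by apply: measurable_integral_ker_signed; exact/measurable_EFinP.
    rewrite (eq_integral (fun eta => \int[Pu eta]_w (psi w)%:E)%E).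
      by rewrite (doobE _ _ psi0 psiM hpsi) ltry.
    move=> eta _; rewrite gee0_abs// integral_ge0// => w _.
    by rewrite lee_fin.
  rewrite (integralB measurableT Gi (finite_measure_integrable_cst _ M measurableT)).
  have cM : (\int[normalized_square nu u]_x (cst M%:E x) = M%:E)%E.
    rewrite integral_cst//.
    by rewrite [X in (_ * X)%E](probability_setT (normalized_square nu u)) mule1.
  rewrite (doobE _ _ psi0 psiM hpsi) [X in (_ - X)%E]cM -EFinB; congr (_ - _)%:E.
  by rewrite -(mulfK Jlim1 K) K1 mul1r mulrC.
(* The same ratio is obtained before the limit: the conditioned law has mass 1, so [c t] is the
   inverse of [J one t]. *)
apply: (@cvg_trans _ ((EFin \o (fun t => J psi t / J one t - M)) t @[t --> +oo])).
  apply: near_eq_cvg; near=> t => /=.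
  have [a0 cE] : 0 <= a t /\
    (forall k C, (forall w, 0 <= k w) -> (forall w, k w <= C) ->
    history_measurable r k ->
    (\int[cond_path_law P nu A t]_w (k (shift_path (a t) w))%:E =
    (c t * J k t)%:E)%E) by near: t; exact: condE.
  have c1 : c t * J one t = 1.
    apply: EFin_inj; rewrite -(cE _ _ one0 one1 hone).
    rewrite (eq_integral (cst 1%E))//.
    by rewrite integral_cst// mul1e; exact: probability_setT.
  have J1 : J one t != 0.
    by apply: contra_eq_neq c1 => ->; rewrite mulr0 eq_sym oner_eq0.
  have mpsia : measurable_fun setT (fun w => psi (shift_path (a t) w)).
    by apply: measurableT_comp => //; exact: measurable_shift_path.
  have [_ subE] := integral_subr_cst M (probability_setT (cond_path_law P nu A t))
    mpsia (fun w => psi_bound _).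
  transitivity (\int[cond_path_law P nu A t]_w
      (psi (shift_path (a t) w) - M)%:E)%E; last first.
    by apply: eq_integral => w _; rewrite addrK.
  rewrite subE (cE _ _ psi0 psiM hpsi) EFinB; congr (_%:E - _)%E.
  by rewrite -(mulfK J1 (c t)) c1 mul1r mulrC.
apply: cvg_EFin; first exact: nearW.
apply: cvgB; last exact: cvg_cst.
by apply: cvgM; [exact: J_cvg psiM _|apply: cvgV => //; exact: J_cvg one1 _].
Unshelve. all: by end_near. Qed.
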